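(* Let $d\in\mathbb{N}$, $\beta>0$, $\mu\le 0$ and $\mathrm{bc}\in\{\emptyset,\mathrm{per},\mathrm{Dir}\}$. Then the sequence $(\nu_{N,\mu}^{(\mathrm{bc})})_{N\in\mathbb{N}}$ of laws of the empirical cycle counts satisfies a large deviation principle on $\ell_1(\mathbb{R})$ with rate $|\Lambda_N|$ and rate function $$I_\mu(x)=\begin{cases}\sum_{k=1}^\infty x_k\Big(\log\frac{x_k}{q_k^{(\mu)}}-1\Big)+\bar q^{(\mu)}, & x\in\ell_1(\mathbb{R}_+),\\ +\infty, &\text{otherwise.}\end{cases}$$
   Context: $\Lambda_N=[-N,N]^d$, $|\Lambda_N|=(2N)^d$. For $\mu\le 0$ and $k\in\mathbb{N}$ put $q_k^{(\mu)}=\frac{e^{\beta\mu k}}{(4\pi\beta)^{d/2}k^{1+d/2}}$ and $\bar q^{(\mu)}=\sum_{k\ge1}q_k^{(\mu)}<\infty$. Let $g_t(x,y)=(4\pi t)^{-d/2}e^{-|x-y|^2/(4t)}$; let $g_t^{(\mathrm{per})}(x,y)=\sum_{z\in\mathbb{Z}^d}g_t(x,y+2Nz)$ (heat kernel on the torus of side length $2N$); let $g_t^{(\mathrm{Dir})}(x,y)$ be the transition density of Brownian motion with generator $\Delta$ killed on leaving $\Lambda_N$. For $\mathrm{bc}=\emptyset$ set $q_k^{(\mathrm{bc},\mu)}=q_k^{(\mu)}$ for all $k$; for $\mathrm{bc}\in\{\mathrm{per},\mathrm{Dir}\}$ set $q_k^{(\mathrm{bc},\mu)}=\frac{e^{\beta\mu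 k}}{k|\Lambda_N|}\int_{\Lambda_N}g^{(\mathrm{bc})}_{k\beta}(x,x)\,dx$ for $k\le N$ and $q_k^{(\mathrm{bc},\mu)}=0$ for $k>N$ (these depend on $N$). Let $(\mathcal{N}_k)_{k\in\mathbb{N}}$ be independent Poisson random variables with means $|\Lambda_N|q_k^{(\mathrm{bc},\mu)}$ ($\mathcal{N}_k$ is the number of points in $\Lambda_N$ carrying a cycle of length $k$ in the reference marked Poisson point process). The empirical cycle count is $\boldsymbol\lambda_N=(\mathcal{N}_k/|\Lambda_N|)_{k\in\mathbb{N}}\in\ell_1(\mathbb{R}_+)$ and $\nu_{N,\mu}^{(\mathrm{bc})}$ is its law. $\ell_1(\mathbb{R}_+)$ is the set of summable sequences with nonnegative entries; $\ell_1(\mathbb{R})$ carries the norm topology. Convention $0\log 0=0$. *)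

(* Defs.v *)
From HB Require Import structures.
From mathcomp Require Import all_boot all_order all_algebra.
From mathcomp Require Import all_classical all_reals all_analysis.

Set Implicit Arguments.
Unset Strict Implicit.
Unset Printing Implicit Defensive.

Import Order.TTheory GRing.Theory Num.Theory.
Import numFieldNormedType.Exports.

Local Open Scope classical_set_scope.
Local Open Scope ring_scope.

(* Sequences indexed by k = 1, 2, 3, ... are functions x : nat -> R in which
   x k stands for the entry of index k.+1. *)

Section l1_space.
Variable R : realType.
Implicit Types x y : nat -> R.

Definition is_l1 : {pred nat -> R} :=
  fun x => `[< summable [set: nat] (EFin \o x) >].

Lemma is_l1P x : reflect (summable [set: nat] (EFin \o x)) (x \in is_l1).
Proof. by rewrite /is_l1 unfold_in; exact: asboolP. Qed.

Lemma esum_normZ (a : R) x :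
  (\esum_(k in [set: nat]) `|(EFin \o (a *: x)) k|
    = `|a|%:E * \esum_(k in [set: nat]) `|(EFin \o x) k|)%E.
Proof.
rewrite -!nneseries_esumT; [|by move=> k; exact: abse_ge0..].
rewrite -nneseriesZl; last by move=> k _; exact: abse_ge0.
by apply: eq_eseriesr => k _ /=; rewrite normrM EFinM.
Qed.

Lemma is_l1_submod_closed : submod_closed is_l1.
Proof.
split.
  apply/is_l1P; rewrite /summable esum1 ?ltry// => k _.
  by rewrite -[RHS]/(0%:E) -[in RHS](normr0 R).
move=> a x y /is_l1P hx /is_l1P hy; apply/is_l1P.
have -> : EFin \o (a *: x + y) = (EFin \o (a *: x)) \+ (EFin \o y).
  by apply/funext.
apply: summableD => //; rewrite /summable esum_normZ.
exact: lte_mul_pinfty.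
Qed.

HB.instance Definition _ :=
  GRing.isSubmodClosed.Build R (nat -> R) is_l1 is_l1_submod_closed.

Record l1 := L1 { l1val :> nat -> R; _ : l1val \in is_l1 }.

HB.instance Definition _ := [isSub for l1val].
HB.instance Definition _ := [Choice of l1 by <:].
HB.instance Definition _ := [SubChoice_isSubLmodule of l1 by <:].

Definition l1_norm (x : l1) : R := fine (\esum_(k in [set: nat]) `|(x k)%:E|)%E.

Lemma l1_normE (x : l1) :
  ((l1_norm x)%:E = \esum_(k in [set: nat]) `|(x k)%:E|)%E.
Proof.
rewrite /l1_norm fineK//.
by case: x => x /= /is_l1P; rewrite (summableE [set: nat] (EFin \o x)).
Qed.

Lemma ler_l1_normD (x y : l1) : l1_norm (x + y) <= l1_norm x + l1_norm y.
Proof.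
rewrite -lee_fin EFinD !l1_normE -esumD; [|by move=> *; exact: abse_ge0..].
by apply: le_esum => k _; exact: ler_normD.
Qed.

Lemma l1_normZ (a : R) (x : l1) : l1_norm (a *: x) = `|a| * l1_norm x.
Proof. by apply: EFin_inj; rewrite EFinM !l1_normE; exact: esum_normZ. Qed.

Lemma l1_norm0_eq0 (x : l1) : l1_norm x = 0 -> x = 0.
Proof.
move=> x0; apply/val_inj/funext => k /=.
have /= := @nneseries_esumT R (fun k => `|(x k)%:E|%E) (fun k => abse_ge0 _).
rewrite -l1_normE x0 => s0.
have h n : (0 <= n)%N -> true -> (0 <= `|(x n)%:E|)%E by rewrite abse_ge0.
have := nneseries_lim_ge k.+1 h; rewrite s0 big_nat_recr//= => hk.
apply/eqP; rewrite -normr_le0 -lee_fin; apply: le_trans hk.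
by rewrite leeDr// sume_ge0.
Qed.

HB.instance Definition _ :=
  Lmodule_isNormed.Build R l1 ler_l1_normD l1_normZ l1_norm0_eq0.

End l1_space.

(* [r] is the rate (speed) of the large deviation principle. *)
Definition LDP (R : realType) (X : topologicalType) (r : nat -> R)
    (nu : nat -> set X -> \bar R) (I : X -> \bar R) : Prop :=
  [/\ (forall x, 0 <= I x)%E,
      lower_semicontinuous I,
      (forall F : set X, closed F ->
        limn_esup (fun N => (r N)^-1%:E * lne (nu N F)) <= - ereal_inf (I @` F))%E
    & (forall G : set X, open G ->
        - ereal_inf (I @` G) <= limn_einf (fun N => (r N)^-1%:E * lne (nu N G)))%E].

Definition mutually_independent (R : realType) d d' (T : measurableType d)
    (T' : measurableType d') (P : probability T R) (J : choiceType)
    (X : J -> T -> T') : Prop :=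
  forall (s : seq J) (A : J -> set T'), uniq s ->
    (forall j, measurable (A j)) ->
    P (\bigcap_(j in [set` s]) X j @^-1` A j)
    = (\prod_(j <- s) P (X j @^-1` A j))%E.

Section euclidean.
Variables (R : realType) (d : nat).

(* |x - y|^2 for the Euclidean norm: the library norm on row vectors is the
   maximum norm. *)
Definition sq_dist (x y : 'rV[R]_d) : R := \sum_(i < d) (x 0 i - y 0 i) ^+ 2.

Definition box (N : nat) : set 'rV[R]_d :=
  [set x | forall i, - N%:R <= x 0 i <= N%:R].

Definition box_vol (N : nat) : R := (2 * N%:R) ^+ d.

Definition borel (A : set 'rV[R]_d) : Prop := <<s open >> A.

End euclidean.

(* Lebesgue integral over R^d of a nonnegative measurable function, as an
   iterated integral (Tonelli). *)
Fixpoint integral_rV (R : realType) (d : nat) : ('rV[R]_d -> \bar R) -> \bar R :=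
  match d return ('rV[R]_d -> \bar R) -> \bar R with
  | 0 => fun f => f 0
  | d'.+1 => fun f =>
      (\int[lebesgue_measure]_(a in [set: R])
         @integral_rV R d' (fun v => f (row_mx (a%:M : 'M[R]_1) v)))%E
  end.

Definition integral_rV_on (R : realType) (d : nat) (A : set 'rV[R]_d)
    (f : 'rV[R]_d -> \bar R) : \bar R := integral_rV (f \_ A).

Definition heat_kernel (R : realType) (d : nat) (t : R) (x y : 'rV[R]_d) : R :=
  (4 * pi * t) `^ (- (d%:R / 2)) * expR (- (sq_dist x y / (4 * t))).

Definition heat_kernel_per (R : realType) (d N : nat) (t : R)
    (x y : 'rV[R]_d) : \bar R :=
  (\esum_(z in [set: 'rV[int]_d])
     (heat_kernel t x (y + (2 * N%:R) *: map_mx intr z))%:E)%E.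

(* Brownian motion with generator Laplacian (not half the Laplacian), started
   at the origin: the coordinates of B t - B s have variance 2 (t - s). *)
Definition brownian_motion (R : realType) (d : nat) dW (W : measurableType dW)
    (P : probability W R) (B : R -> W -> 'rV[R]_d) : Prop :=
  [/\ forall w, B 0 w = 0,
      forall w, {within `[0, +oo[, continuous (fun t => B t w)},
      forall (t : R) i, 0 <= t -> measurable_fun [set: W] (fun w => B t w 0 i),
      forall (s t : R) i (A : set R), 0 <= s -> s < t -> measurable A ->
        P [set w | A (B t w 0 i - B s w 0 i)]
        = normal_prob 0 (Num.sqrt (2 * (t - s))) A
    & forall (n : nat) (tau : nat -> R), 0 <= tau 0%N ->
        (forall j, tau j <= tau j.+1) ->
        mutually_independent P (fun (ji : 'I_n * 'I_d) (w : W) =>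
          B (tau ji.1.+1) w 0 ji.2 - B (tau ji.1) w 0 ji.2)].

(* p is the (continuous version of the) transition density of Brownian motion
   with generator Laplacian killed on leaving D. *)
Definition killed_transition_density (R : realType) (d : nat)
    (D : set 'rV[R]_d) (p : R -> 'rV[R]_d -> 'rV[R]_d -> R) : Prop :=
  [/\ forall (t : R) x y, 0 < t -> D x -> D y -> 0 <= p t x y,
      forall t : R, 0 < t ->
        {within D `*` D, continuous (fun xy => p t xy.1 xy.2)}
    & exists (dW : measure_display) (W : measurableType dW)
        (P : probability W R) (B : R -> W -> 'rV[R]_d),
        brownian_motion P B /\
        forall (t : R) x (A : set 'rV[R]_d), 0 < t -> D x -> borel A -> A `<=` D ->
          P [set w | A (x + B t w) /\
                     forall s : R, 0 <= s <= t -> D (x + B s w)]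
          = integral_rV_on A (fun y => (p t x y)%:E)].

Variant boundary_condition := Free | Periodic | Dirichlet.

Section cycle_weights.
Variables (R : realType) (d : nat) (beta mu : R).

Definition q (k : nat) : R :=
  expR (beta * mu * k%:R)
  / ((4 * pi * beta) `^ (d%:R / 2) * k%:R `^ (1 + d%:R / 2)).

Definition qbar : \bar R := (\sum_(0 <= k <oo) (q k.+1)%:E)%E.

(* pDir N is the Dirichlet kernel of the box of side length 2N. *)
Definition q_bc (pDir : nat -> R -> 'rV[R]_d -> 'rV[R]_d -> R)
    (bc : boundary_condition) (N k : nat) : R :=
  let cutoff (g : R -> 'rV[R]_d -> 'rV[R]_d -> \bar R) : R :=
    if (k <= N)%N then
      expR (beta * mu * k%:R) / (k%:R * box_vol R d N)
      * fine (integral_rV_on (@box R d N) (fun x => g (k%:R * beta) x x))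
    else 0 in
  match bc with
  | Free => q k
  | Periodic => cutoff (@heat_kernel_per R d N)
  | Dirichlet => cutoff (fun t x y => (pDir N t x y)%:E)
  end.

Definition rate_function (x : l1 R) : \bar R :=
  if `[< forall k, 0 <= x k >] then
    (\sum_(0 <= k <oo) (x k * (ln (x k / q k.+1) - 1))%:E + qbar)%E
  else +oo%E.

End cycle_weights.

Section empirical_cycle_count.
Variables (R : realType) (d N : nat).

(* The sequence of cycle counts is summable almost surely; on the exceptional
   null event, the value 0 is used. *)
Definition empirical_cycle_count (T : Type) (Nk : nat -> T -> nat) (w : T) :
    l1 R :=
  insubd (0 : l1 R) (fun k => (Nk k w)%:R / box_vol R d N).

Definition law_cycle_count dT (T : measurableType dT) (P : probability T R)
    (Nk : nat -> T -> nat) : set (l1 R) -> \bar R :=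
  pushforward P (empirical_cycle_count Nk : T -> g_sigma_algebraType (@open (l1 R))).

End empirical_cycle_count.

(* Main.v *)
Require Import Defs.
From HB Require Import structures.
From mathcomp Require Import all_boot all_order all_algebra.
From mathcomp Require Import all_classical all_reals all_analysis.
From mathcomp Require Import measurable_realfun.
From mathcomp Require Import ring lra.

(** Write a_k for the weights of the box N and q_k for their limits, V for the
    volume of the box and h(u, q) = u (log (u / q) - 1) + q, so that the rate
    function is the sum of the h(x_k, q_k).

    The large deviation principle only uses that a_k <= 2 q_k for N large,
    that a_k -> q_k for each k, and that sum_k q_k e^{w_k} is finite for some
    weights w_k -> oo.
    - Upper bound.  The exponential Chebyshev inequality for finite linear
      combinations of the counts bounds the probability of a half-space
      [sum_{k<n} (theta_k x_k - q_k (e^{theta_k} - 1)) > c] by e^{- V (c - o(1))};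
      by Young duality these half-spaces cover {I > c}.  The sets
      [x >= 0, sum_k w_k x_k <= b] are compact in l1 and exponentially tight,
      so finitely many half-spaces suffice.
    - Lower bound.  Near x, force the count of each k < K to be the integer
      part of V x_k and all the other counts to vanish; the latter costs
      exp(- V sum_{k>=K} a_k), which is negligible as K -> oo.

    For periodic boundary conditions, a_k / q_k is a theta series in N^2 / (k beta)
    and k <= N.  In the Dirichlet case, a_k <= q_k since the killed density is
    below the free one.  Conversely, at distance r from the boundary, a path that
    exits and returns to a small cube around its starting point makes after its
    first exit (on a dyadic grid of times) an increment of size about r; this
    increment is independent of the past and, uniformly in its duration u <= t,
    its density (4 pi u)^(-d/2) exp(- r^2 / 16 u) is small when r is large. *)

Set Implicit Arguments.
Unset Strict Implicit.
Unset Printing Implicit Defensive.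

Import Order.TTheory GRing.Theory Num.Theory.
Import numFieldNormedType.Exports.

Local Open Scope classical_set_scope.
Local Open Scope ring_scope.

(** * Independent Poisson counts *)

Section independent_counts.
Context d (T : measurableType d) (R : realType) (P : probability T R).
Implicit Types (X : nat -> T -> nat) (f : nat -> nat -> \bar R).

Lemma measurable_preimage_nat (Y : T -> nat) (A : set nat) :
  measurable_fun [set: T] Y -> measurable (Y @^-1` A).
Proof. by move=> mY; rewrite -[_ @^-1` _]setTI; exact: mY. Qed.

Lemma measurable_comp_nat d' (T' : measurableType d') (Y : T -> nat)
    (f : nat -> T') :
  measurable_fun [set: T] Y -> measurable_fun [set: T] (f \o Y).
Proof. by move=> mY; apply: measurableT_comp => //. Qed.

Lemma nneseries_single (F : nat -> \bar R) (n : nat) :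
  (forall k, 0 <= F k)%E -> (forall k, k != n -> F k = 0)%E ->
  (\sum_(0 <= k <oo) F k = F n)%E.
Proof.
move=> F0 Fn; rewrite (@nneseriesD1 _ _ n xpredT)//=.
by rewrite eseries0 ?adde0// => k _ /= kn; exact: Fn.
Qed.

(** Partition according to the value of [Y]. The second factor [g] stays arbitrary: it is 1 when an
    expectation is computed, and the product of the remaining factors when independence is used. *)
Lemma integral_nat_comp (Y : T -> nat) (f : nat -> \bar R) (g : T -> \bar R) :
  measurable_fun [set: T] Y -> (forall j, 0 <= f j)%E ->
  (forall w, 0 <= g w)%E -> measurable_fun [set: T] g ->
  (\int[P]_w (f (Y w) * g w)
   = \sum_(0 <= j <oo) f j * \int[P]_w ((\1_[set j] (Y w))%:E * g w))%E.
Proof.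
move=> mY f0 g0 mg.
have mi j : measurable_fun [set: T] (fun w => ((\1_[set j] (Y w))%:E * g w)%E).
  apply: emeasurable_funM => //; apply/measurable_EFinP.
  exact: (measurable_comp_nat (\1_[set j] : nat -> R)).
have i0 j w : (0 <= (\1_[set j] (Y w))%:E * g w)%E.
  by rewrite mule_ge0// lee_fin.
transitivity (\int[P]_w (\sum_(0 <= j <oo)
    f j * ((\1_[set j] (Y w))%:E * g w)))%E.
  apply: eq_integral => w _; rewrite (nneseries_single (n := Y w)).
  - by rewrite indicE mem_set//= mul1e.
  - by move=> k; rewrite mule_ge0.
  - move=> k kY; rewrite indicE memNset ?mul0e ?mule0//= => /esym/eqP.
    by rewrite (negbTE kY).
rewrite integral_nneseries//.
- by apply: eq_eseriesr => j _; rewrite ge0_integralZl.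
- by move=> j; apply: emeasurable_funM.
- by move=> j w _; rewrite mule_ge0.
Qed.

Lemma integral_nat_compE (Y : T -> nat) (f : nat -> \bar R) :
  measurable_fun [set: T] Y -> (forall j, 0 <= f j)%E ->
  (\int[P]_w f (Y w) = \sum_(0 <= j <oo) f j * P (Y @^-1` [set j]))%E.
Proof.
move=> mY f0; have := integral_nat_comp mY f0 (g := cst 1%E).
under eq_integral do rewrite mule1.
move=> ->//; apply: eq_eseriesr => j _; congr (_ * _)%E.
under eq_integral do rewrite mule1.
rewrite -[X in P X]setIT -integral_indic//; exact: measurable_preimage_nat.
Qed.

Lemma emeasurable_prod (I : Type) (s : seq I) (Q : pred I) (F : I -> T -> \bar R) :
  (forall i, measurable_fun [set: T] (F i)) ->
  measurable_fun [set: T] (fun w => \prod_(i <- s | Q i) F i w)%E.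
Proof.
move=> mF; elim: s => [|i s IH].
  by rewrite (_ : (fun w => _) = cst 1%E)//; apply/funext => w; rewrite big_nil.
have [Qi|Qi] := boolP (Q i).
  rewrite (_ : (fun w => _) = (F i \* (fun w => \prod_(i <- s | Q i) F i w))%E).
    exact: emeasurable_funM.
  by apply/funext => w; rewrite big_cons Qi.
rewrite (_ : (fun w => _) = (fun w => \prod_(i <- s | Q i) F i w)%E)//.
by apply/funext => w; rewrite big_cons (negbTE Qi).
Qed.

(* The factors are replaced one at a time by linear combinations of indicators,
   for which the formula is the definition of independence. *)
Lemma integral_prod_independent X m f :
  mutually_independent P X -> (forall k, measurable_fun [set: T] (X k)) ->
  (forall k j, 0 <= f k j)%E ->
  (forall k, \int[P]_w f k (X k w) \is a fin_num)%E ->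
  (\int[P]_w (\prod_(0 <= k < m) f k (X k w))
   = \prod_(0 <= k < m) \int[P]_w f k (X k w))%E.
Proof.
move=> hind mX.
have iindic k A : (\int[P]_w (\1_A (X k w))%:E = P (X k @^-1` A))%E.
  by rewrite -[X in P X]setIT -integral_indic//; exact: measurable_preimage_nat.
pose indicator (g : nat -> \bar R) := exists A, g = fun j => (\1_A j)%:E.
(* Induction on a bound [n] such that all factors of index at least [n] are indicators. *)
suff H n : forall f, (forall k j, 0 <= f k j)%E ->
    (forall k, \int[P]_w f k (X k w) \is a fin_num)%E ->
    (forall k, (n <= k)%N -> indicator (f k)) ->
    (\int[P]_w (\prod_(0 <= k < m) f k (X k w))
     = \prod_(0 <= k < m) \int[P]_w f k (X k w))%E.
  (* Factors of index at least [m] do not occur in the product, so they may be replaced by the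
     indicator of everything. *)
  move=> f0 ff; pose f' k := if (k < m)%N then f k else (fun j => (\1_setT j)%:E).
  have := H m f'; under eq_integral => w _.
    rewrite (eq_big_nat _ _ (F2 := fun k => f k (X k w))); last first.
      by move=> k /andP[_ km]; rewrite /f' km.
    over.
  rewrite (eq_big_nat _ _ (F2 := fun k => \int[P]_w f k (X k w))%E); last first.
    by move=> k /andP[_ km]; rewrite /f' km.
  apply; first by move=> k j; rewrite /f'; case: ifP => // _; rewrite lee_fin.
    by move=> k; rewrite /f'; case: ifP => // _; rewrite iindic fin_num_measure//;
      exact: measurable_preimage_nat.
  by move=> k mk; rewrite /f' ltnNge mk; exists setT.
elim: n => [|n IH] {}f f0 ff fi.
  have [A fA] := choice (fun k => fi k (leq0n k)).
  have mA k : measurable (X k @^-1` A k) by exact: measurable_preimage_nat.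
  have E k : (\int[P]_w f k (X k w) = P (X k @^-1` A k))%E.
    by under eq_integral do rewrite fA; rewrite iindic.
  under eq_big_nat do rewrite E.
  rewrite -hind ?iota_uniq// -[X in P X]setIT -integral_indic//; last first.
    by apply: fin_bigcap_measurable => [|k _].
  apply: eq_integral => w _; rewrite indicE.
  case: (boolP (w \in _)) => [/set_mem h|h].
    rewrite big_seq big1// => k ks; rewrite fA indicE mem_set//.
    exact: (h k).
  have [k km wk] : exists2 k, k \in index_iota 0 m & X k w \notin A k.
    apply: contrapT => nh; move/negP: h; apply; rewrite inE => k /= ks.
    by apply: contrapT => wk; apply: nh; exists k => //; apply/negP; rewrite inE.
  by rewrite (bigD1_seq k)//= ?iota_uniq// fA indicE (negbTE wk) mul0e.
(* If [m <= n], the factor of index [n] is absent from the product and can be replaced by the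
   constant 1. *)
have [nm|mn] := ltnP n m; last first.
  pose f' k := if k == n then (fun j => (\1_setT j)%:E) else f k.
  have ff' k : (0 <= k < m)%N -> f k = f' k.
    move=> /andP[_ km]; rewrite /f' ifF//; apply/negbTE.
    by rewrite neq_ltn (leq_trans km mn).
  under eq_integral => w _.
    rewrite (eq_big_nat _ _ (F2 := fun k => f' k (X k w))); last first.
      by move=> k km; rewrite ff'.
    over.
  rewrite (eq_big_nat _ _ (F2 := fun k => \int[P]_w f' k (X k w))%E); last first.
    by move=> k km; rewrite ff'.
  apply: IH => [k j|k|k nk]; rewrite /f'; first by case: ifP => // _; rewrite lee_fin.
    by case: ifP => // _; rewrite iindic fin_num_measure//; exact: measurable_preimage_nat.
  case: eqVneq => [_|kn]; first by exists setT.
  by apply: fi; rewrite ltn_neqAle eq_sym kn.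
have nI : n \in index_iota 0 m by rewrite mem_index_iota.
have uI : uniq (index_iota 0 m) by exact: iota_uniq.
have mf k : measurable_fun [set: T] (fun w => f k (X k w)).
  exact: (measurable_comp_nat (f k)).
under eq_integral do rewrite (bigD1_seq n)//=.
rewrite integral_nat_comp//; last 2 first.
- by move=> w; apply: prode_ge0.
- exact: emeasurable_prod.
(* The induction hypothesis, with factor [n] replaced by the indicator of the value [j]; summing
   over [j] with coefficients [f n j] then restores the factor. *)
have step j : (\int[P]_w ((\1_[set j] (X n w))%:E *
      \prod_(0 <= k < m | k != n) f k (X k w)) =
    P (X n @^-1` [set j]) * \prod_(0 <= k < m | k != n) \int[P]_w f k (X k w))%E.
  pose f' k := if k == n then (fun i => (\1_[set j] i)%:E) else f k.
  have := IH f'; under eq_integral do rewrite (bigD1_seq n)//=.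
  rewrite (bigD1_seq n)//= /f' eqxx.
  rewrite (eq_bigr (fun k => \int[P]_w f k (X k w))%E); last first.
    by move=> k /negbTE ->.
  under eq_integral => w _.
    rewrite (eq_bigr (fun k => f k (X k w))); last by move=> k /negbTE ->.
    over.
  move=> ->.
  - by congr (_ * _)%E; rewrite iindic.
  - by move=> k i; case: ifP => // _; rewrite lee_fin.
  - move=> k; case: ifP => // _; rewrite iindic fin_num_measure//.
    exact: measurable_preimage_nat.
  - move=> k nk; case: eqVneq => [_|kn]; first by exists [set j].
    by apply: fi; rewrite ltn_neqAle eq_sym kn.
under eq_eseriesr do rewrite step.
rewrite (bigD1_seq n)//= (integral_nat_compE (mX n) (f0 n)).
under eq_eseriesr do rewrite muleA.
have /fineK <- : (\prod_(0 <= k < m | k != n) \int[P]_w f k (X k w) \is a fin_num)%E.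
  by apply: prode_fin_num.
under eq_eseriesr do rewrite muleC.
by rewrite nneseriesZl 1?muleC// => j _; rewrite mule_ge0.
Qed.
End independent_counts.

(** * Exponential moments and point masses of the Poisson law *)

Section poisson_facts.
Context {R : realType}.

Lemma poisson_prob_set1 (r : R) (j : nat) : 0 < r ->
  poisson_prob r 0 [set j] = (poisson_pmf r j)%:E.
Proof.
by move=> r0; rewrite /poisson_prob r0 esum_set1// lee_fin poisson_pmf_ge0.
Qed.

Lemma poisson_prob_set10 (r : R) : 0 <= r ->
  poisson_prob r 0 [set 0%N] = (expR (- r))%:E.
Proof.
rewrite le_eqVlt => /predU1P[<-|r0].
  by rewrite /poisson_prob ltxx oppr0 expR0 diracE mem_set.
rewrite poisson_prob_set1// /poisson_pmf r0 expr0 fact0 invr1 !mul1r//.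
Qed.

Lemma poisson_mgf (r theta : R) : 0 <= r ->
  (\sum_(0 <= j <oo) (expR (theta * j%:R))%:E * poisson_prob r 0 [set j]
   = (expR (r * (expR theta - 1)))%:E)%E.
Proof.
rewrite le_eqVlt => /predU1P[<-|r0].
  rewrite (nneseries_single (n := 0%N)).
  - by rewrite /poisson_prob ltxx diracE mem_set//= mulr0 expR0 mul0r expR0 mule1.
  - by move=> k; rewrite mule_ge0// lee_fin expR_ge0.
  - move=> k k0; rewrite /poisson_prob ltxx diracE memNset ?mule0//=.
    by move=> /esym/eqP; rewrite (negbTE k0).
have re0 : 0 < r * expR theta by rewrite mulr_gt0// expR_gt0.
have E j : ((expR (theta * j%:R))%:E * poisson_prob r 0 [set j] =
  (expR (r * (expR theta - 1)))%:E * (poisson_pmf (r * expR theta) j)%:E)%E.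
  rewrite poisson_prob_set1// -!EFinM; congr EFin.
  rewrite /poisson_pmf r0 re0 exprMn -expRM_natr mulrBr mulr1 expRD.
  rewrite [expR (- (_ * _))]expRN.
  have := expR_gt0 (r * expR theta) => e0.
  field; rewrite ?gt_eqF//.
under eq_eseriesr do rewrite E.
rewrite nneseriesZl; last by move=> j _; rewrite lee_fin poisson_pmf_ge0.
rewrite nneseries_esumT; last by move=> j; rewrite lee_fin poisson_pmf_ge0.
have h : poisson_prob (r * expR theta) 0 [set: nat] = 1%E.
  exact: probability_setT.
by rewrite -[RHS]mule1 -[in RHS]h /poisson_prob re0.
Qed.

(** A crude Stirling bound. The induction step is e <= ((m + 2) / (m + 1))^(m + 2), which follows
    from ln (1 - x) <= - x at x = 1 / (m + 2). *)
Lemma fact_le (m : nat) : (m`!)%:R <= m.+1%:R ^+ m.+1 * expR (- m%:R) :> R.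
Proof.
elim: m => [|m IH]; first by rewrite fact0 oppr0 expR0 mulr1.
rewrite factS natrM (le_trans (ler_wpM2l _ IH))//.
have m1 : (0:R) < m.+1%:R by rewrite ltr0n.
have m2 : (0:R) < m.+2%:R by rewrite ltr0n.
have -> : expR (- m.+1%:R) = expR (-1) * expR (- m%:R) :> R.
  by rewrite -expRD -opprD addrC natr1.
rewrite [leLHS]mulrA -exprS [leRHS]mulrA.
rewrite ler_pM2r ?expR_gt0//.
have : expR 1 * m.+1%:R ^+ m.+2 <= m.+2%:R ^+ m.+2 :> R; last first.
  by move=> h; rewrite expRN ler_pdivlMr ?expR_gt0// mulrC.
rewrite -ler_pdivlMr ?exprn_gt0// -expr_div_n.
have -> : m.+2%:R / m.+1%:R = (1 - m.+2%:R^-1)^-1 :> R.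
  move: m1 m2; rewrite -(natr1 m.+1); set x := m.+1%:R => x0 x1.
  by field; rewrite addrK !gt_eqF.
rewrite -[leRHS]lnK ?posrE ?exprn_gt0 ?invr_gt0 ?subr_gt0 ?invf_lt1 ?ltr1n//.
rewrite ler_expR lnXn ?invr_gt0 ?subr_gt0 ?invf_lt1 ?ltr1n//.
rewrite lnV ?posrE ?subr_gt0 ?invf_lt1 ?ltr1n//.
have h : ln (1 - m.+2%:R^-1) <= - m.+2%:R^-1 :> R.
  by rewrite le_ln1Dx// ltrN2 invf_lt1 ?ltr1n.
rewrite -[leRHS]mulr_natl -ler_pdivrMl// mulr1 lerNr//.
Qed.

(** Having m + 1 rather than m inside the logarithm keeps the case m = 0 uniform and costs only o(V)
    in the exponent when m is of order V. *)
Lemma poisson_pmf_lower (r : R) (m : nat) : 0 < r ->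
  expR (m%:R * ln r - m.+1%:R * ln m.+1%:R + m%:R - r) <= poisson_pmf r m.
Proof.
move=> r0; rewrite /poisson_pmf r0 !expRD.
have m1 : (0:R) < m.+1%:R by rewrite ltr0n.
rewrite ler_pM2r ?expR_gt0// expRM_natl lnK ?posrE//.
rewrite expRN expRM_natl lnK ?posrE//.
rewrite -mulrA ler_pM2l ?exprn_gt0//.
apply: (@le_trans _ _ ((m.+1%:R ^+ m.+1 * expR (- m%:R))^-1)).
  by rewrite invfM expRN invrK.
rewrite lef_pV2 ?posrE ?mulr_gt0 ?exprn_gt0 ?expR_gt0 ?ltr0n ?fact_gt0//.
exact: fact_le.
Qed.

End poisson_facts.

(** * Chernoff bound and point probabilities for independent Poisson counts *)

Section poisson_counts.
Context d (T : measurableType d) (R : realType) (P : probability T R).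
Variables (X : nat -> T -> nat) (r : nat -> R).
Hypothesis mX : forall k, measurable_fun [set: T] (X k).
Hypothesis iX : mutually_independent P X.
Hypothesis r0 : forall k, 0 <= r k.
Hypothesis XP : forall k A, P (X k @^-1` A) = poisson_prob (r k) 0 A.

Lemma integral_expR_poisson k (theta : R) :
  (\int[P]_w (expR (theta * (X k w)%:R))%:E
   = (expR (r k * (expR theta - 1)))%:E)%E.
Proof.
rewrite (integral_nat_compE P (f := fun j => (expR (theta * j%:R))%:E) (mX k)).
  by under eq_eseriesr do rewrite XP; exact: poisson_mgf.
by move=> j; rewrite lee_fin expR_ge0.
Qed.

Lemma measurable_counts_sum (n : nat) (theta : nat -> R) :
  measurable_fun [set: T] (fun w => \sum_(0 <= k < n) theta k * (X k w)%:R).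
Proof.
apply: measurable_sum => k.
exact: (measurable_comp_nat (fun j => theta k * j%:R)).
Qed.

Lemma measurable_counts_ge (n : nat) (theta : nat -> R) (b : R) :
  measurable [set w | b <= \sum_(0 <= k < n) theta k * (X k w)%:R].
Proof.
set S := fun w => \sum_(0 <= k < n) theta k * (X k w)%:R.
have mS : measurable_fun [set: T] S by exact: measurable_counts_sum.
have := mS measurableT [set` `[b, +oo[]; rewrite setTI (_ : S @^-1` _ = [set w | b <= S w]).
  by apply; exact: measurable_itv.
by apply/seteqP; split => w /=; rewrite in_itv/= andbT.
Qed.

Lemma poisson_chernoff (n : nat) (theta : nat -> R) (b : R) :
  (P [set w | (b <= \sum_(0 <= k < n) theta k * (X k w)%:R)%R]
   <= (expR (\sum_(0 <= k < n) r k * (expR (theta k) - 1) - b))%:E)%E.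
Proof.
set S := fun w => \sum_(0 <= k < n) theta k * (X k w)%:R.
have mS : measurable_fun [set: T] S by exact: measurable_counts_sum.
have mE : measurable [set w | b <= S w] by exact: measurable_counts_ge.
rewrite -[X in P X]setIT -integral_indic//.
have mexp : measurable_fun [set: T] (fun w => (expR (S w))%:E).
  by apply/measurable_EFinP; exact: measurableT_comp.
(* Exponential Markov inequality: the indicator of [b <= S] is at most e^(S - b). *)
apply: (@le_trans _ _ (\int[P]_w ((expR (- b))%:E * (expR (S w))%:E))%E).
  apply: ge0_le_integral => //.
  - by apply/measurable_EFinP; exact: measurable_indic.
  - exact: emeasurable_funM.
  - move=> w _; rewrite -EFinM lee_fin -expRD indicE.
    case: (boolP (w \in _)) => [/set_mem/= bS|_]; last exact: expR_ge0.
    by rewrite -expR0 ler_expR addrC subr_ge0.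
rewrite ge0_integralZl_EFin ?expR_ge0//.
rewrite addrC expRD EFinM lee_pmul2l ?lte_fin ?expR_gt0//.
under eq_integral.
  move=> w _; rewrite /S expR_sum -prodEFin.
  over.
rewrite /= (@integral_prod_independent _ _ _ P X n
  (fun k j => (expR (theta k * j%:R))%:E))//.
- by rewrite expR_sum -prodEFin; under eq_bigr do rewrite integral_expR_poisson.
- by move=> k; rewrite integral_expR_poisson.
Qed.

(** The event is the decreasing limit of its finite-dimensional versions. Each index k >= K
    contributes the factor e^(- r_k), so together these contribute at least e^(- s). *)
Lemma poisson_point_ge (K : nat) (m : nat -> nat) (s : R) :
  (forall k, (K <= k)%N -> m k = 0%N) ->
  (forall n, \sum_(K <= k < n) r k <= s) ->
  (\prod_(0 <= k < K) poisson_prob (r k) 0 [set m k] * (expR (- s))%:E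
   <= P (\bigcap_k (X k @^-1` [set m k])))%E.
Proof.
move=> mK rs.
pose F n := \bigcap_(k in [set` index_iota 0 n]) (X k @^-1` [set m k]).
have mXk k : measurable (X k @^-1` [set m k]) by exact: measurable_preimage_nat.
have mF n : measurable (F n) by apply: fin_bigcap_measurable.
have FE : \bigcap_n F n = \bigcap_k (X k @^-1` [set m k]).
  apply/seteqP; split => w /= h.
    by move=> k _; apply: (h k.+1 I k); rewrite /= mem_index_iota/=.
  by move=> n _ k _; exact: h.
have : (P \o F) n @[n --> \oo] --> P (\bigcap_n F n).
  apply: nonincreasing_cvg_mu => //.
  - by rewrite (le_lt_trans (probability_le1 _ _)) ?ltry.
  - by rewrite FE; exact: bigcapT_measurable.
  - move=> a b ab; apply/subsetPset => w h k; rewrite /= mem_index_iota => /andP[_ ka].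
    by apply: h; rewrite /= mem_index_iota/= (leq_trans ka).
rewrite FE => cvgP; rewrite -(cvg_lim _ cvgP)//.
apply: lime_ge; first by apply/cvg_ex; eexists; exact: cvgP.
exists K => // n /= Kn.
have -> : P (F n) = (\prod_(0 <= k < n) poisson_prob (r k) 0 [set m k])%E.
  by rewrite /F iX ?iota_uniq//; apply: eq_bigr => k _; exact: XP.
rewrite (big_cat_nat (leq0n K) Kn)/= lee_pmul//.
  by apply: prode_ge0.
rewrite (@eq_big_nat _ _ _ K n _ (fun k => (expR (- r k))%:E)); last first.
  by move=> k /andP[Kk _]; rewrite mK// poisson_prob_set10.
by rewrite prodEFin -expR_sum sumrN lee_fin ler_expR lerN2.
Qed.

End poisson_counts.

(** * The rate function *)

Section poisson_rate.
Context {R : realType}.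
Implicit Types (q u theta b : R).

(** The Cramér rate of a Poisson variable of mean q, that is the Legendre transform of theta |-> q
    (e^theta - 1). At u = 0 the product with u vanishes, so the value is q, in accordance with 0 log
    0 = 0. *)
Definition poisson_rate q u : R := u * (ln (u / q) - 1) + q.

(** Fenchel-Young inequality: for u > 0, multiply 1 + z <= e^z by u at z = theta - ln (u / q). *)
Lemma poisson_rate_young q u theta : 0 < q -> 0 <= u ->
  theta * u - q * (expR theta - 1) <= poisson_rate q u.
Proof.
move=> q0; rewrite le_eqVlt => /predU1P[<-|u0].
  rewrite /poisson_rate mulr0 mul0r !add0r mulrBr mulr1 opprB.
  by rewrite gerBl mulr_ge0 ?expR_ge0// ltW.
have uq0 : 0 < u / q by rewrite divr_gt0.
have := expR_ge1Dx (theta - ln (u / q)).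
rewrite expRB lnK ?posrE// invf_div => /(ler_wpM2l (ltW u0)).
rewrite /poisson_rate; set l := ln _; set e := expR _.
have -> : u * (e * (q / u)) = q * e by field; rewrite gt_eqF.
lra.
Qed.

Lemma poisson_rate_ge0 q u : 0 < q -> 0 <= u -> 0 <= poisson_rate q u.
Proof.
by move=> q0 /(poisson_rate_young 0 q0); rewrite expR0 mul0r subrr mulr0 subr0.
Qed.

Lemma poisson_rate_dual q u b : 0 < q -> 0 <= u -> b < poisson_rate q u ->
  exists theta, b < theta * u - q * (expR theta - 1).
Proof.
move=> q0; rewrite le_eqVlt => /predU1P[<-|u0].
  rewrite /poisson_rate mul0r add0r => bq.
  have h0 : 0 < (q - b) / q / 2 by rewrite !divr_gt0// subr_gt0.
  (* At u = 0 the supremum q is approached only as theta -> -oo. This theta makes q e^theta = (q -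
     b) / 2, hence the value (q + b) / 2 > b. *)
  exists (ln ((q - b) / q / 2)); rewrite lnK ?posrE// mulr0.
  have -> : q * ((q - b) / q / 2 - 1) = (q - b) / 2 - q by field; rewrite gt_eqF.
  lra.
(* For u > 0 the supremum is attained at theta = ln (u / q). *)
move=> bu; exists (ln (u / q)); rewrite lnK ?posrE ?divr_gt0//.
have -> : q * (u / q - 1) = u - q by field; rewrite gt_eqF.
by move: bu; rewrite /poisson_rate; lra.
Qed.

Definition entropy_rate (q x : nat -> R) : \bar R :=
  if `[< forall k, 0 <= x k >] then
    (\sum_(0 <= k <oo) (poisson_rate (q k) (x k))%:E)%E
  else +oo%E.

(** The series in [rate_function] may have terms of both signs. Since [qbar] is finite, it is the
    difference of two convergent series with nonnegative terms, and [qbar] can be distributed over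
    the terms. *)
Lemma rate_functionE d (beta mu : R) (x : l1 R) :
  (forall k, 0 < q d beta mu k.+1) -> (qbar d beta mu < +oo)%E ->
  rate_function d beta mu x = entropy_rate (fun k => q d beta mu k.+1) x.
Proof.
move=> q0 qoo; rewrite /rate_function /entropy_rate.
case: ifPn => [/asboolP x0|//].
set qq := fun k => q d beta mu k.+1.
have cq : (\sum_(0 <= k < n) (qq k)%:E)%E @[n --> \oo] --> qbar d beta mu.
  by apply: is_cvg_nneseries => k _ _; rewrite lee_fin; exact: ltW (q0 k).
have ch : (\sum_(0 <= k < n) (poisson_rate (qq k) (x k))%:E)%E @[n --> \oo] -->
    (\sum_(0 <= k <oo) (poisson_rate (qq k) (x k))%:E)%E.
  by apply: is_cvg_nneseries => k _ _; rewrite lee_fin; exact: poisson_rate_ge0 (q0 k) (x0 k).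
have qbar_fin : qbar d beta mu \is a fin_num.
  rewrite ge0_fin_numE//; apply: nneseries_ge0 => k _ _.
  by rewrite lee_fin; exact: ltW (q0 k).
have qbarN_fin : (- qbar d beta mu)%E \is a fin_num by rewrite fin_numN.
have h' := @cvgeB _ \oo _ R _ _ _ _ (fin_num_adde_defl _ qbarN_fin) ch cq.
have h := cvg_lim _ (h' _).
rewrite -[RHS](subeK _ qbar_fin); congr (_ + _)%E.
rewrite -h//; congr (limn _); apply/funext => n.
rewrite -fin_num_sumeN//.
rewrite -big_split/=; apply: eq_bigr => k _.
by rewrite -EFinB /poisson_rate addrK.
Qed.

Lemma entropy_rate_ge0 (q x : nat -> R) : (forall k, 0 < q k) ->
  (0 <= entropy_rate q x)%E.
Proof.
move=> q0; rewrite /entropy_rate; case: ifPn => [/asboolP x0|_]; last exact: leey.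
by apply: nneseries_ge0 => k _ _; rewrite lee_fin; exact: poisson_rate_ge0 (q0 k) (x0 k).
Qed.

Lemma entropy_rate_dual (q x : nat -> R) (c : R) : (forall k, 0 < q k) ->
  (forall k, 0 <= x k) -> (c%:E < entropy_rate q x)%E ->
  exists n (theta : nat -> R),
    c < \sum_(0 <= k < n) (theta k * x k - q k * (expR (theta k) - 1)).
Proof.
move=> q0 x0; rewrite /entropy_rate; case: ifPn => [_|/asboolP//] cI.
have [n cn] : exists n, c < \sum_(0 <= k < n) poisson_rate (q k) (x k).
  apply: contrapT => /forallNP h; move: cI; apply/negP; rewrite -leNgt.
  apply: lime_le.
    apply: is_cvg_nneseries => k _ _.
    by rewrite lee_fin; exact: poisson_rate_ge0 (q0 k) (x0 k).
  by apply: nearW => n; rewrite sumEFin lee_fin leNgt; apply/negP.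
(* The gap above [c] is divided by n + 1, so that n losses of size [e] do not exhaust it; n = 0 is
   covered too. *)
pose e := (\sum_(0 <= k < n) poisson_rate (q k) (x k) - c) / n.+1%:R.
have e0 : 0 < e by rewrite divr_gt0// subr_gt0.
have ek k : poisson_rate (q k) (x k) - e < poisson_rate (q k) (x k).
  by rewrite gtrBl.
have [theta htheta] := choice (fun k => poisson_rate_dual (q0 k) (x0 k) (ek k)).
exists n, theta; apply: (@lt_le_trans _ _ (\sum_(0 <= k < n) (poisson_rate (q k) (x k) - e))).
  rewrite sumrB big_const_nat subn0 iter_addr_0.
  set s := \sum_(0 <= k < n) _ in e e0 ek htheta *.
  rewrite ltrBrDr -ltrBrDl -mulr_natr /e -mulrA gtr_pMr ?subr_gt0//.
  by rewrite mulrC ltr_pdivrMr// mul1r ltr_nat.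
by apply: ler_sum => k _; exact: ltW.
Qed.

End poisson_rate.

(** * The space l1 *)

Section l1_topology.
Context {R : realType}.
Implicit Types (x y : l1 R) (w : nat -> R).

Lemma l1_partial_sum_le x n : \sum_(0 <= k < n) `|x k| <= `|x|.
Proof.
rewrite -lee_fin -sumEFin [X in (_ <= X)%E]l1_normE -nneseries_esumT//.
by apply: nneseries_lim_ge => k _ _; rewrite lee_fin.
Qed.

Lemma l1_norm_le x M c : (forall n, (M <= n)%N -> \sum_(0 <= k < n) `|x k| <= c) ->
  `|x| <= c.
Proof.
move=> xc; rewrite -lee_fin [X in (X <= _)%E]l1_normE -nneseries_esumT//.
apply: lime_le.
  by apply: is_cvg_nneseries => k _ _; exact: abse_ge0.
by exists M => // n Mn; rewrite sumEFin lee_fin; exact: xc.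
Qed.

Lemma is_l1_partial_sum (x : nat -> R) c :
  (forall n, \sum_(0 <= k < n) `|x k| <= c) -> x \in @is_l1 R.
Proof.
move=> xc; apply/is_l1P; rewrite /summable -nneseries_esumT//.
apply: (@le_lt_trans _ _ c%:E); last exact: ltry.
apply: lime_le.
  by apply: is_cvg_nneseries => k _ _; exact: abse_ge0.
by apply: nearW => n; rewrite sumEFin lee_fin; exact: xc.
Qed.

Lemma l1_coord_le x k : `|x k| <= `|x|.
Proof.
apply: le_trans (l1_partial_sum_le x k.+1).
by rewrite big_nat_recr//= lerDr sumr_ge0.
Qed.

Lemma l1_coord_continuous k : continuous (fun x : l1 R => x k).
Proof.
suff H (x : l1 R) : (fun y : l1 R => y k) @ x --> x k by exact: H.
apply/(@cvgrPdist_lt _ _ _ _ (nbhs_filter x)) => e e0.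
apply/nbhs_ballP; exists e => // y.
by rewrite -ball_normE/=; apply: le_lt_trans; exact: (l1_coord_le (x - y) k).
Qed.

Lemma l1_linear_continuous n (theta : nat -> R) :
  continuous (fun x : l1 R => \sum_(0 <= k < n) theta k * x k).
Proof.
suff H (x : l1 R) : (fun y : l1 R => \sum_(0 <= k < n) theta k * y k) @ x -->
    \sum_(0 <= k < n) theta k * x k by exact: H.
have FF := nbhs_filter x; elim: n => [|n IH].
  rewrite big_nil (_ : (fun y : l1 R => _) = cst 0); first exact: cvg_cst.
  by apply/funext => y; rewrite big_nil.
rewrite big_nat_recr//= (_ : (fun y : l1 R => _) =
    (fun y : l1 R => \sum_(0 <= k < n) theta k * y k) \+
    (fun y : l1 R => theta n * y n)); last first.
  by apply/funext => y; rewrite big_nat_recr.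
apply: (@cvgD _ _ _ _ FF) => //.
apply: (@cvgM _ _ _ FF); first exact: cvg_cst.
exact: (@l1_coord_continuous n x).
Qed.

Definition weight_ball w b : set (l1 R) :=
  [set x | (forall k, 0 <= x k) /\ forall n, \sum_(0 <= k < n) w k * x k <= b].

(** Markov inequality for sums: beyond [M] each unit of mass weighs at least [c]. *)
Lemma weighted_tail_le w b c (x : nat -> R) M n : 0 < c ->
  (forall k, 0 <= w k) -> (forall k, (M <= k)%N -> c <= w k) ->
  (forall k, 0 <= x k) -> \sum_(0 <= k < n) w k * x k <= b ->
  \sum_(M <= k < n) x k <= b / c.
Proof.
move=> c0 w0 cw x0 xb; rewrite ler_pdivlMr// mulrC mulr_sumr; apply: le_trans xb.
have [Mn|nM] := leqP M n; last first.
  by rewrite big_geq ?sumr_ge0// 1?ltnW// => k _; rewrite mulr_ge0.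
rewrite [leRHS](big_cat_nat (leq0n M) Mn)/=.
rewrite -[leLHS]add0r lerD ?sumr_ge0//; first by move=> k _; rewrite mulr_ge0.
by apply: ler_sum_nat => k /andP[Mk _]; rewrite ler_wpM2r// cw.
Qed.

(** Coordinates lie in [0, b / c], so Tychonoff provides a pointwise cluster point. Because w -> oo,
    tails are uniformly small on the ball, which turns pointwise closeness into closeness in
    norm. *)
Lemma weight_ball_compact w b c : 0 < c -> (forall k, c <= w k) ->
  w @ \oo --> +oo -> compact (weight_ball w b).
Proof.
move=> c0 cw woo F FF FK.
have w_gt0 k : 0 < w k := lt_le_trans c0 (cw k).
have Kcoord x k : weight_ball w b x -> 0 <= x k <= b / c.
  move=> [x0 xb]; rewrite x0/= ler_pdivlMr//.
  apply: le_trans (xb k.+1); rewrite big_nat_recr//= mulrC.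
  rewrite -[leLHS]add0r lerD ?sumr_ge0//.
    by move=> i _; rewrite mulr_ge0// ltW.
  by rewrite ler_wpM2r.
pose G : set_system (forall k : nat, R) := (fun x : l1 R => l1val x) @ F.
have GP : ProperFilter G by exact: fmap_proper_filter.
have cI (k : nat) : compact [set` `[(0 : R), b / c]] by exact: segment_compact.
have GI : G [set f : forall k : nat, R | forall k, [set` `[(0 : R), b / c]] (f k)].
  rewrite /G/=; apply: filterS FK => x Kx k /=.
  by rewrite in_itv/= Kcoord.
have [a [aI aG]] := @tychonoff nat (fun=> R) _ cI G GP GI.
(* Clustering in the product topology: every set of the filter contains a point of the ball close to
   [a] in the first [M] coordinates. *)
have close A (M : nat) (e : R) : F A -> 0 < e ->
    exists x, [/\ A x, weight_ball w b x & forall k, (k < M)%N -> `|x k - a k| < e].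
  move=> FA e0.
  have GA : G (@l1val R @` (A `&` weight_ball w b)).
    rewrite /G /=; have : F (A `&` weight_ball w b) by exact: filterI.
    by apply: filterS => x Ax; exists x.
  pose B := [set f : forall k : nat, R | forall k : 'I_M, `|f k - a k| < e].
  have nB : nbhs (a : prod_topology (fun=> R)) B.
    apply: (@filter_forall _ 'I_M (fun k (f : nat -> R) => `|f k - a k| < e) _
      (nbhs_filter (a : prod_topology (fun=> R)))) => k.
    have ne : nbhs (a k : R) [set z : R | `|z - a k| < e].
      by apply/nbhs_ballP; exists e => // z; rewrite -ball_normE/= distrC.
    exact: (@proj_continuous nat (fun=> R) k a _ ne).
  have [f [[x [Ax Kx] <-] Bx]] := aG _ _ GA nB.
  by exists x; split => // k kM; exact: (Bx (Ordinal kM)).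
have a0 k : 0 <= a k by have := aI k; rewrite /= in_itv/= => /andP[].
have ab n : \sum_(0 <= k < n) w k * a k <= b.
  apply/ler_addgt0Pr => e e0.
  (* The weighted bound passes to [a]: coordinate errors e / (1 + sum of weights) have total weight
     at most e, and the 1 keeps the denominator positive. *)
  have W0 : 0 < 1 + \sum_(0 <= k < n) w k.
    by rewrite ltr_pwDl// sumr_ge0// => k _; exact: ltW.
  have [x [_ [x0 xb] xa]] := close setT n _ filterT (divr_gt0 e0 W0).
  have : \sum_(0 <= k < n) w k * a k <= \sum_(0 <= k < n) w k * x k
      + \sum_(0 <= k < n) w k * (e / (1 + \sum_(0 <= k < n) w k)).
    rewrite -big_split/=; apply: ler_sum_nat => k /andP[_ kn].
    rewrite -mulrDr; apply: ler_wpM2l; first exact: ltW.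
    rewrite -lerBlDl.
    by have := xa k kn; rewrite distrC => /ltW; exact: le_trans (ler_norm _).
  move=> /le_trans; apply; apply: lerD; first exact: xb.
  rewrite -mulr_suml mulrA ler_pdivrMr// mulrC ler_wpM2l ?lerDr// ltW//.
have aK : (a : nat -> R) \in @is_l1 R.
  apply: (@is_l1_partial_sum _ (b / c)) => n.
  rewrite (eq_bigr a); last by move=> k _; rewrite ger0_norm.
  apply: (weighted_tail_le c0 _ _ a0 (ab n)) => k; first exact: ltW.
  by move=> _.
exists (L1 aK); split; first by split.
move=> A B FA /nbhs_ballP[e /= e0 eB].
have b0 : 0 <= b by have := ab 0%N; rewrite big_geq.
have b40 : 0 < 4 * (b + 1) / e by rewrite divr_gt0// mulr_gt0// ltr_wpDl.
(* With weights at least 4 (b + 1) / e beyond [M], the tail of any point of the ball is at most e /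
   4. The distance is then bounded by three quarters of e: the head and the two tails. *)
have [M _ wM] : \forall k \near \oo, 4 * (b + 1) / e <= w k.
  by move/cvgryPge : woo => /(_ (4 * (b + 1) / e)).
have e4 : 0 < e / 4 / M.+1%:R by rewrite !divr_gt0.
have [x [Ax [x0 xb] xa]] := close A M _ FA e4.
exists x; split => //; apply: eB; rewrite -ball_normE/= distrC.
apply: (@le_lt_trans _ _ (e / 4 + (e / 4 + e / 4))); last by lra.
have tail (y : nat -> R) : (forall k, 0 <= y k) ->
    (forall n, \sum_(0 <= k < n) w k * y k <= b) ->
    forall n, \sum_(M <= k < n) y k <= e / 4.
  move=> y0 yb n; have w0 k : 0 <= w k by exact: ltW.
  apply: le_trans (weighted_tail_le b40 w0 wM y0 (yb n)) _.
  rewrite invf_div mulrA ler_pdivrMr ?mulr_gt0// ?ltr_wpDl//.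
  have : 0 < e by []. nra.
apply: (@l1_norm_le _ M) => n Mn; rewrite (big_cat_nat (leq0n M) Mn)/= lerD//.
  apply: (@le_trans _ _ (\sum_(0 <= k < M) e / 4 / M.+1%:R)).
    by apply: ler_sum_nat => k /andP[_ kM]; exact/ltW/xa.
  rewrite sumr_const_nat subn0 -[X in X <= _]mulr_natr.
  rewrite -[e / 4 / _ * _]mulrA; apply: ler_piMr; first by rewrite divr_ge0// ltW.
  by rewrite mulrC ler_pdivrMr// mul1r ler_nat.
apply: (@le_trans _ _ (\sum_(M <= k < n) (x k + a k))).
  apply: ler_sum => k _; apply: (le_trans (ler_normB _ _)).
  by rewrite !ger0_norm.
rewrite big_split/=; apply: lerD; apply: tail => //.
Qed.

End l1_topology.

(** * Large deviations of independent Poisson counts *)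

Lemma nonneg_tail_le (R : realType) (y : nat -> R) (c e : R) :
  (forall k, 0 <= y k) -> (forall n, \sum_(0 <= k < n) y k <= c) -> 0 < e ->
  \forall K \near \oo, forall n, \sum_(K <= k < n) y k <= e.
Proof.
move=> y0 yc e0.
pose E := range (fun n => \sum_(0 <= k < n) y k).
have Esup : has_sup E.
  by split; [exists (\sum_(0 <= k < 0) y k); exists 0%N
            |exists c => _ [n _ <-]; exact: yc].
have [_ [K _ <-] supK] := sup_adherent e0 Esup.
exists K => // K' /= KK' n; have [K'n|nK'] := leqP K' n; last first.
  by rewrite big_geq ?ltW// ltnW.
have : \sum_(0 <= k < n) y k <= sup E.
  by apply: sup_upper_bound => //; exists n.
rewrite (big_cat_nat (leq0n K') K'n)/= (big_cat_nat (leq0n K) KK')/=.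
have : 0 <= \sum_(K <= i < K') y i by apply: sumr_ge0.
by move: supK; lra.
Qed.

(** * Rescaled counts as random elements of l1 *)

Section scaled_counts.
Context {R : realType}.
Implicit Types (v : R) (X : nat -> nat).

(** The value of [empirical_cycle_count] at one outcome, with an arbitrary scale [v] in place of the
    volume. *)
Definition scaled_seq v (X : nat -> nat) : l1 R :=
  insubd (0 : l1 R) (fun k => (X k)%:R / v).

Lemma scaled_seq_val v X c : 
  (forall n, \sum_(0 <= k < n) `|(X k)%:R / v| <= c) ->
  (scaled_seq v X : nat -> R) = fun k => (X k)%:R / v.
Proof.
move=> h; rewrite /scaled_seq -[LHS]/(val _) val_insubd ifT//.
exact: is_l1_partial_sum h.
Qed.

(** A summable sequence tends to 0, and one whose entries are integer multiples of 1 / v is then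
    eventually 0. Any other sequence of counts receives the default value 0. *)
Lemma scaled_seq_eq0 v X : 0 < v ->
  ~ (exists s : seq nat, forall k, X k = nth 0%N s k) -> scaled_seq v X = 0.
Proof.
move=> v0 nX; apply/val_inj; rewrite val_insubd; case: ifPn => // hX; exfalso.
apply: nX; pose x := L1 hX.
have : cvgn (series (fun k => `|x k|)).
  apply: nondecreasing_is_cvgn.
    move=> m n mn; rewrite /series/= (big_cat_nat (leq0n m) mn)/=.
    by rewrite lerDl sumr_ge0.
  by exists `|x| => _ [n _ <-]; exact: l1_partial_sum_le.
move=> /cvg_series_cvg_0 /cvgrPdist_lt /(_ v^-1).
rewrite invr_gt0 => /(_ v0)[K _ hK].
exists [seq X k | k <- iota 0 K] => k.
have [kK|Kk] := ltnP k K; first by rewrite (nth_map 0%N) ?size_iota// nth_iota.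
rewrite nth_default ?size_map ?size_iota//; apply/eqP.
have := hK k Kk; rewrite sub0r normrN normr_id /x/= normrM normfV (gtr0_norm v0).
rewrite normr_nat -[ltRHS]mul1r ltr_pM2r ?invr_gt0//.
by rewrite (_ : 1 = 1%:R)// ltr_nat ltnS leqn0.
Qed.

(** No condition on [A] is needed for measurability: apart from the default 0, the values come from
    finitely supported integer sequences, which are countably many and are coded by [seq nat]. *)
Lemma measurable_scaled_seq d (T : measurableType d) v (X : nat -> T -> nat)
    (A : set (l1 R)) : 0 < v -> (forall k, measurable_fun [set: T] (X k)) ->
  measurable ((fun w => scaled_seq v (X ^~ w)) @^-1` A).
Proof.
move=> v0 mX.
pose E (s : seq nat) := \bigcap_k (X k @^-1` [set nth 0%N s k]).
have mE s : measurable (E s).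
  by apply: bigcapT_measurable => k; exact: measurable_preimage_nat.
have vE s w : E s w -> X ^~ w = nth 0%N s.
  by move=> Ew; apply/funext => k; exact: Ew.
have cseq : countable [set: seq nat] by exact: countableP.
pose B := \bigcup_s (E s `&` [set _ | A (scaled_seq v (nth 0%N s))]).
pose C := ~` (\bigcup_s E s) `&` [set _ | A 0].
have mP (p : Prop) : measurable [set _ : T | p].
  have [hp|hp] := pselect p.
    by rewrite (_ : [set _ | p] = setT)//; apply/seteqP; split.
  by rewrite (_ : [set _ | p] = set0)//; apply/seteqP; split.
suff -> : (fun w => scaled_seq v (X ^~ w)) @^-1` A = B `|` C.
  apply: measurableU.
    by apply: countable_bigcupT_measurable => // s; exact: measurableI.
  apply: measurableI => //; apply: measurableC.
  exact: countable_bigcupT_measurable.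
apply/seteqP; split => w /=.
  move=> Aw; have [[s _ Es]|nE] := pselect ((\bigcup_s E s) w).
    by left; exists s => //; split => //=; rewrite -(vE _ _ Es).
  right; split => //=; rewrite -(@scaled_seq_eq0 v (X ^~ w))// => -[s hs].
  by apply: nE; exists s => // k _; exact: hs.
case=> [[s _ [Es As]]|[nE A0]]; first by rewrite /= (vE _ _ Es).
rewrite scaled_seq_eq0// => -[s hs].
by apply: nE; exists s => // k _; exact: hs.
Qed.

End scaled_counts.

Section limsup_facts.
Context {R : realType}.
Implicit Types (u : (\bar R)^nat) (l : \bar R).

Lemma limn_esup_near_le u l : (\forall n \near \oo, u n <= l)%E -> (limn_esup u <= l)%E.
Proof.
move=> ul; apply: (@le_trans _ _ (ereal_sup (u @` [set n | (u n <= l)%E]))).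
  by apply: ereal_inf_lbound; exists [set n | (u n <= l)%E].
by apply: ge_ereal_sup => _ [n /= h <-].
Qed.

Lemma limn_einf_near_ge u l : (\forall n \near \oo, l <= u n)%E -> (l <= limn_einf u)%E.
Proof.
move=> ul; rewrite /limn_einf leeNr; apply: limn_esup_near_le.
by apply: filterS ul => n; rewrite leeN2.
Qed.

(** An estimate at a level c2 below x may be lost down to any c1 < c2. The form includes x = +oo,
    where the infimum of the rate function over a closed set can lie. *)
Lemma lee_oppr_dense (x y : \bar R) :
  (forall c1 c2 : R, c1 < c2 -> (c2%:E < x)%E -> (y <= (- c1)%:E)%E) -> (y <= - x)%E.
Proof.
case: x => [r| |] h; last by rewrite leey.
  apply/lee_addgt0Pr => e e0; rewrite -EFinN -EFinD.
  have -> : - r + e = - (r - e) by rewrite opprB addrC.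
  apply: (h _ (r - e / 2)); first by lra.
  by rewrite lte_fin; lra.
rewrite leeNy_eq; apply/eqP/eq_ninfty => A.
by have := h (- A) (- A + 1); rewrite opprK ltrDl ltr01 ltry; apply.
Qed.

Lemma lne_expR (x : R) : lne (expR x)%:E = x%:E.
Proof. by rewrite lne_EFin ?expR_gt0// expRK. Qed.

Lemma lne_le_expR (c x : R) (y : \bar R) : 0 < c -> (0 <= y)%E ->
  (y <= (expR (c * x))%:E)%E -> ((c^-1)%:E * lne y <= x%:E)%E.
Proof.
move=> c0 y0 yx; rewrite lee_pdivrMl// -EFinM -lne_expR.
by rewrite lee_lne// in_itv/= ?y0 ?leey// lee_fin expR_ge0.
Qed.

Lemma expR_le_lne (c x : R) (y : \bar R) : 0 < c ->
  ((expR (c * x))%:E <= y)%E -> (x%:E <= (c^-1)%:E * lne y)%E.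
Proof.
move=> c0 yx; rewrite lee_pdivlMl// -EFinM -lne_expR.
have e0 : (0 <= (expR (c * x))%:E)%E by rewrite lee_fin expR_ge0.
by rewrite lee_lne// in_itv/= ?e0 ?leey// (le_trans e0 yx).
Qed.

End limsup_facts.

Lemma measure_bigsetU_le d (T : measurableType d) (R : realType)
    (P : probability T R) (I : eqType) (s : seq I) (H : I -> set T) (e : R) :
  (forall i, measurable (H i)) -> (forall i, i \in s -> (P (H i) <= e%:E)%E) ->
  (P (\big[setU/set0]_(i <- s) H i) <= ((size s)%:R * e)%:E)%E.
Proof.
move=> mH; elim: s => [|i s IH] He; first by rewrite big_nil measure0 mul0r.
rewrite big_cons /= -natr1 mulrDl mul1r addrC EFinD.
apply: (le_trans (measureU2 _ _ _)) => //; first exact: bigsetU_measurable.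
apply: leeD; first by apply: He; rewrite mem_head.
by apply: IH => j js; apply: He; rewrite inE js orbT.
Qed.

(** * Asymptotics of a single Poisson point probability *)

Section poisson_point_limit.
Context {R : realType}.
Variables (V a : nat -> R) (q : R).
Hypothesis Voo : V @ \oo --> +oo.
Hypothesis q0 : 0 < q.
Hypothesis aq : a @ \oo --> q.

Let V_gt (A : R) : \forall N \near \oo, A < V N.
Proof. by move/cvgryPgt : Voo; apply. Qed.

Let invV0 : (V N)^-1 @[N --> \oo] --> 0.
Proof.
apply/cvgrPdist_lt => e e0; near=> N.
have VN : e^-1 < V N by near: N; exact: V_gt.
have V0 : 0 < V N by rewrite (lt_trans _ VN)// invr_gt0.
rewrite sub0r normrN gtr0_norm ?invr_gt0//.
by rewrite -[ltRHS]invrK ltf_pV2// posrE ?invr_gt0.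
Unshelve. all: by end_near. Qed.

(** Write ln V = 2 ln (sqrt V) < 2 sqrt V. *)
Let lnV0 : ln (V N) / V N @[N --> \oo] --> 0.
Proof.
apply/cvgrPdist_lt => e e0; near=> N.
have VN : Num.max 1 ((2 / e) ^+ 2) < V N by near: N; exact: V_gt.
have [V1 Ve] : 1 < V N /\ (2 / e) ^+ 2 < V N by apply/andP; rewrite -gt_max.
have V0 : 0 < V N by rewrite (lt_trans _ V1).
have s0 : 0 < Num.sqrt (V N) by rewrite sqrtr_gt0.
rewrite sub0r normrN ger0_norm ?divr_ge0 ?ln_ge0 ?ltW//.
rewrite ltr_pdivrMr// -[in ltLHS](sqr_sqrtr (ltW V0)) lnXn//.
have : ln (Num.sqrt (V N)) < Num.sqrt (V N) by exact: ln_sublinear.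
have : 2 / e < Num.sqrt (V N).
  rewrite -[ltLHS]ger0_norm ?divr_ge0 ?ltW// -sqrtr_sqr.
  by rewrite ltr_sqrt.
rewrite ltr_pdivrMr// => h1 h2.
rewrite -[X in _ < _ * X](sqr_sqrtr (ltW V0)).
have : 2 * Num.sqrt (V N) < Num.sqrt (V N) * e * Num.sqrt (V N).
  by rewrite ltr_pM2r.
by rewrite expr2 mulr2n; lra.
Unshelve. all: by end_near. Qed.

Lemma poisson_point_near (x delta : R) : 0 <= x -> 0 < delta ->
  \forall N \near \oo,
    ((expR (- (V N * (poisson_rate q x + delta))))%:E
     <= poisson_prob (V N * a N) 0 [set Num.truncn (V N * x)])%E.
Proof.
move=> x0 d0.
have a0 : \forall N \near \oo, 0 < a N.
  by move/cvgrPdist_lt : aq => /(_ q q0); apply: filterS => N; rewrite ltr_distl; lra.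
(* At x = 0 the probability is exactly e^(- V a); this case is separate because the limit below uses
   continuity of ln at x. *)
have [->|xn0] := eqVneq x 0.
  near=> N; rewrite mulr0 truncn0 poisson_prob_set10; last first.
    by rewrite mulr_ge0// ltW//; near: N => //; exact: V_gt.
  rewrite lee_fin ler_expR lerN2 ler_wpM2l//; first by rewrite ltW//; near: N; exact: V_gt.
  rewrite /poisson_rate mul0r add0r; near: N.
  move/cvgrPdist_le : aq => /(_ _ d0); apply: filterS => N.
  by rewrite ler_distl; lra.
have {}x0 : 0 < x by rewrite lt_neqAle eq_sym xn0.
pose m N := Num.truncn (V N * x).
pose u N := (m N).+1%:R / V N.
have ux : u N @[N --> \oo] --> x.
  apply/cvgrPdist_le => e e0.
  have : \forall N \near \oo, (V N)^-1 < e.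
    move/cvgrPdist_lt : invV0 => /(_ _ e0); apply: filterS => N.
    by rewrite sub0r normrN; exact: le_lt_trans (ler_norm _).
  apply: filterS2 (V_gt 0) => N V0 Ve.
  have := truncn_itv (ltW (mulr_gt0 V0 x0)); rewrite -/(m N) => /andP[m1 m2].
  rewrite distrC ler_distl /u; apply/andP; split.
    by rewrite ler_pdivlMr// mulrBl [x * _]mulrC (le_trans _ (ltW m2))// gerBl mulr_ge0 ?ltW.
  rewrite ler_pdivrMr// mulrDl [x * _]mulrC -natr1 lerD//.
  by rewrite -ler_pdivrMr// mul1r ltW.
(* The exponent of [poisson_pmf_lower] at mean V a and count m, divided by V, where m / V = u - 1 /
   V. The ln V terms cancel up to ln V / V. *)
pose g N := (u N - (V N)^-1) * ln (a N) - u N * ln (u N) - ln (V N) / V N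
  + (u N - (V N)^-1) - a N.
have gx : g N @[N --> \oo] --> - poisson_rate q x.
  have -> : - poisson_rate q x = (x - 0) * ln q - x * ln x - 0 + (x - 0) - q.
    by rewrite /poisson_rate ln_div ?posrE//; ring.
  have lna : ln (a N) @[N --> \oo] --> ln q.
    by apply: (cvg_comp _ _ aq); exact: continuous_ln.
  have lnu : ln (u N) @[N --> \oo] --> ln x.
    by apply: (cvg_comp _ _ ux); exact: continuous_ln.
  have u'x : u N - (V N)^-1 @[N --> \oo] --> x - 0 by exact: cvgB.
  apply: cvgB => //; apply: cvgD => //; apply: cvgB => //.
  by apply: cvgB; exact: cvgM.
near=> N.
have V0 : 0 < V N by near: N; exact: V_gt.
have aN : 0 < a N by near: N.
rewrite poisson_prob_set1 ?mulr_gt0// -/(m N) lee_fin.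
apply: le_trans (poisson_pmf_lower _ _); last by rewrite mulr_gt0.
rewrite ler_expR lnM ?posrE//.
have -> : (m N).+1%:R = u N * V N by rewrite /u divfK// gt_eqF.
have -> : (m N)%:R = u N * V N - 1 by rewrite /u divfK ?gt_eqF// -natr1 addrK.
have uN : 0 < u N by rewrite /u divr_gt0.
rewrite lnM ?posrE//.
have : - poisson_rate q x - delta <= g N.
  near: N; move/cvgrPdist_le : gx => /(_ _ d0); apply: filterS => N.
  by rewrite ler_distl; lra.
move=> /(ler_wpM2l (ltW V0)).
have -> : V N * g N = (u N * V N - 1) * (ln (V N) + ln (a N)) -
    u N * V N * (ln (u N) + ln (V N)) + (u N * V N - 1) - V N * a N.
  by rewrite /g; field; rewrite gt_eqF.
by lra.
Unshelve. all: by end_near. Qed.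

End poisson_point_limit.

Lemma lee_prod (R : realDomainType) (I : Type) (s : seq I) (Q : pred I)
    (f g : I -> \bar R) : (forall i, Q i -> 0 <= f i <= g i)%E ->
  (\prod_(i <- s | Q i) f i <= \prod_(i <- s | Q i) g i)%E.
Proof.
move=> fg; suff : (0 <= \prod_(i <- s | Q i) f i <= \prod_(i <- s | Q i) g i)%E.
  by case/andP.
apply: (big_ind2 (fun x y => (0 <= x <= y)%E)) => [||i Qi]; last exact: fg.
  by rewrite lexx andbT lee_fin.
move=> x1 x2 y1 y2 /andP[x0 x12] /andP[y0 y12].
by rewrite mule_ge0//= lee_pmul.
Qed.

Lemma row_mx_scalar0 (K : nzRingType) d (a : K) (v : 'rV[K]_d) :
  (row_mx (a%:M : 'M[K]_1) v : 'rV[K]_d.+1) 0 ord0 = a.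
Proof.
have := row_mxEl (a%:M : 'M[K]_1) v 0 ord0.
rewrite [X in _ = X]mxE eqxx mulr1n => h.
rewrite -[RHS]h; by congr (fun_of_matrix _ _ _); apply: val_inj.
Qed.

Lemma row_mx_scalarS (K : nzRingType) d (a : K) (v : 'rV[K]_d) i :
  (row_mx (a%:M : 'M[K]_1) v : 'rV[K]_d.+1) 0 (lift ord0 i) = v 0 i.
Proof.
rewrite -[RHS](row_mxEr (a%:M : 'M[K]_1) v 0 i).
by congr (fun_of_matrix _ _ _); apply: val_inj.
Qed.

(** * Iterated integrals over boxes and cubes *)

Section integral_rV_facts.
Context {R : realType}.

(** True for arbitrary nonnegative functions, since the integral is a supremum over simple functions
    below the integrand. Inner integrals of an iterated integral can thus be compared without
    proving them measurable. *)
Lemma ge0_le_integralT dT (T : measurableType dT) (m : {measure set T -> \bar R})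
    (f g : T -> \bar R) : (forall x, 0 <= f x)%E -> (forall x, f x <= g x)%E ->
  (\int[m]_x f x <= \int[m]_x g x)%E.
Proof.
move=> f0 fg; have g0 x : (0 <= g x)%E by exact: le_trans (fg x).
rewrite !ge0_integralTE//; apply: ereal_sup_le => _ [h /= hf <-].
by exists h => //= x; exact: le_trans (fg x).
Qed.

Lemma integral_rV_ge0 d (f : 'rV[R]_d -> \bar R) :
  (forall x, 0 <= f x)%E -> (0 <= integral_rV f)%E.
Proof.
elim: d f => [|d IH] f f0 /=; first exact: f0.
by apply: integral_ge0 => a _; apply: IH => v; exact: f0.
Qed.

Lemma integral_rV0 d : integral_rV (fun _ : 'rV[R]_d => 0%E) = 0%E.
Proof.
elim: d => [|d IH] //=.
by under eq_integral do rewrite IH; rewrite integral0.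
Qed.

Lemma ge0_le_integral_rV d (f g : 'rV[R]_d -> \bar R) :
  (forall x, 0 <= f x)%E -> (forall x, f x <= g x)%E ->
  (integral_rV f <= integral_rV g)%E.
Proof.
elim: d f g => [|d IH] f g f0 fg /=; first exact: fg.
apply: ge0_le_integralT => a; first by apply: integral_rV_ge0.
by apply: IH.
Qed.

Lemma ge0_le_integral_rV_on d (A B : set 'rV[R]_d) (f g : 'rV[R]_d -> \bar R) :
  A `<=` B -> (forall x, A x -> 0 <= f x)%E -> (forall x, A x -> f x <= g x)%E ->
  (forall x, B x -> 0 <= g x)%E ->
  (integral_rV_on A f <= integral_rV_on B g)%E.
Proof.
move=> AB f0 fg g0; apply: ge0_le_integral_rV => x; rewrite !patchE.
  by case: ifPn => // /set_mem; exact: f0.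
case: ifPn => [/set_mem Ax|_]; first by rewrite mem_set ?fg//; exact: AB.
by case: ifPn => // /set_mem; exact: g0.
Qed.

Definition cube d (lo hi : 'I_d -> R) : set 'rV[R]_d :=
  [set x | forall i, lo i <= x 0 i <= hi i].

Lemma integral_rV_on_cube d (lo hi : 'I_d -> R) (c : R) :
  (forall i, lo i <= hi i) -> 0 <= c ->
  integral_rV_on (cube lo hi) (fun=> c%:E) = (c * \prod_(i < d) (hi i - lo i))%:E.
Proof.
move=> + c0; rewrite /integral_rV_on; elim: d lo hi => [|d IH] lo hi lohi.
  rewrite /= big_ord0 mulr1 patchE mem_set//.
  by move=> -[].
pose lo' i := lo (lift ord0 i); pose hi' i := hi (lift ord0 i).
have {}IH := IH lo' hi' (fun i => lohi _).
(* The slice of the cube at first coordinate [a] is the lower-dimensional cube when [a] lies in the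
   first interval, and is empty otherwise. *)
rewrite /= [LHS](_ : _ = \int[lebesgue_measure]_(a in [set: R])
    ((fun=> (c * \prod_(i < d) (hi' i - lo' i))%:E) \_ `[lo ord0, hi ord0]) a)%E; last first.
  apply: eq_integral => a _; rewrite patchE; case: ifPn => alohi.
    rewrite -IH; congr integral_rV; apply/funext => v; rewrite !patchE.
    congr (if _ then _ else _); apply/idP/idP => /set_mem h; apply/mem_set => i.
      by have := h (lift ord0 i); rewrite row_mx_scalarS.
    case: (unliftP ord0 i) => [j|] ->; first by rewrite row_mx_scalarS; exact: h.
    by rewrite row_mx_scalar0; move: alohi => /set_mem /=; rewrite in_itv.
  rewrite (_ : (fun v => _) = fun=> 0%E); last first.
    apply/funext => v; rewrite patchE memNset// => /(_ ord0).
    rewrite row_mx_scalar0 => h; move/negP: alohi; apply.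
    by apply/mem_set; rewrite /= in_itv/= h.
  by rewrite -[RHS](integral_rV0 d).
rewrite -integral_mkcond integral_cst//= lebesgue_measure_itv/= lte_fin.
rewrite big_ord_recl; case: ltP => h; first by rewrite -EFinB -EFinM mulrAC mulrA.
by rewrite (@le_anti _ _ (lo ord0) (hi ord0)) ?lohi ?h// subrr mul0r mulr0 mule0.
Qed.

End integral_rV_facts.

(** * Large deviation bounds from domination, convergence and one exponential moment *)

Section poisson_ldp.
Context {R : realType}.
Variables (V : nat -> R) (a : nat -> nat -> R) (q w : nat -> R) (C S c : R).
Variables (dT : nat -> measure_display) (T : forall N, measurableType (dT N)).
Variables (P : forall N, probability (T N) R) (X : forall N, nat -> T N -> nat).
Arguments X : clear implicits.
Hypothesis V_gt0 : forall N, (0 < N)%N -> 0 < V N.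
Hypothesis Voo : V @ \oo --> +oo.
Hypothesis q0 : forall k, 0 < q k.
Hypothesis c0 : 0 < c.
Hypothesis cw : forall k, c <= w k.
Hypothesis woo : w @ \oo --> +oo.
Hypothesis qw : forall n, \sum_(0 <= k < n) q k * expR (w k) <= S.
Hypothesis a0 : forall N k, (0 < N)%N -> 0 <= a N k.
Hypothesis C0 : 0 < C.
Hypothesis aC : \forall N \near \oo, forall k, a N k <= C * q k.
Hypothesis aq : forall k, a N k @[N --> \oo] --> q k.
Hypothesis mX : forall N k, measurable_fun [set: T N] (X N k).
Hypothesis iX : forall N, (0 < N)%N -> mutually_independent (P N) (X N).
Hypothesis XP : forall N k, (0 < N)%N -> forall A,
  P N (X N k @^-1` A) = poisson_prob (V N * a N k) 0 A.

Let nu N (A : set (l1 R)) : \bar R :=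
  P N ((fun t => scaled_seq (V N) (X N ^~ t)) @^-1` A).

Let V_gt (A : R) : \forall N \near \oo, A < V N.
Proof. by move/cvgryPgt : Voo; apply. Qed.

Let N_gt0 : \forall N \near \oo, (0 < N)%N.
Proof. by exists 1%N. Qed.

Let w_ge0 k : 0 <= w k. Proof. exact: le_trans (ltW c0) (cw k). Qed.

(** The limit of the logarithmic moment generating function of the counts, divided by V. *)
Let dual n (theta : nat -> R) : R := \sum_(0 <= k < n) q k * (expR (theta k) - 1).

Let halfspace (b : R) (i : nat * (nat -> R)) : set (l1 R) :=
  [set x | b < \sum_(0 <= k < i.1) i.2 k * x k - dual i.1 i.2].

Let halfspace_open b i : open (halfspace b i).
Proof.
have -> : halfspace b i = (fun x : l1 R => \sum_(0 <= k < i.1) i.2 k * x k) @^-1`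
    [set r | b + dual i.1 i.2 < r].
  by apply/seteqP; split => x; rewrite /halfspace/= ltrBrDr.
by apply: open_comp; [move=> x _; exact: l1_linear_continuous|exact: open_gt].
Qed.

Let halfspace_entropy b i (x : l1 R) : (forall k, 0 <= x k) -> halfspace b i x ->
  (b%:E < entropy_rate q x)%E.
Proof.
move=> x0; rewrite /halfspace/= /dual -sumrB => bx.
rewrite /entropy_rate ifT; last exact/asboolP.
have h0 k : (0 <= k)%N -> true -> (0 <= (poisson_rate (q k) (x k))%:E)%E.
  by move=> _ _; rewrite lee_fin poisson_rate_ge0.
apply: lt_le_trans (nneseries_lim_ge i.1 h0).
rewrite sumEFin lte_fin; apply: lt_le_trans bx _.
by apply: ler_sum => k _; exact: poisson_rate_young.
Qed.

(** On nonnegative sequences the rate is a supremum of continuous affine functions; a negative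
    coordinate stays negative nearby, where the rate is +oo. *)
Lemma entropy_rate_lsc : lower_semicontinuous (entropy_rate q : l1 R -> \bar R).
Proof.
move=> x b bI; have [x0|/existsNP[k xk]] := pselect (forall k, 0 <= x k).
  have [n [theta h]] := entropy_rate_dual q0 x0 bI.
  exists (halfspace b (n, theta)).
    apply: open_nbhs_nbhs; split; first exact: halfspace_open.
    by rewrite /halfspace/= /dual -sumrB.
  move=> y; have [y0|ny0] := pselect (forall k, 0 <= y k).
    exact: halfspace_entropy.
  by move=> _; rewrite /entropy_rate ifF ?ltry//; apply/negbTE/asboolP.
exists ((fun y : l1 R => y k) @^-1` [set r | r < 0]).
  apply: open_nbhs_nbhs; split; last by rewrite /= ltNge; exact/negP.
  by apply: open_comp; [move=> z _; exact: l1_coord_continuous|exact: open_lt].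
move=> y /= yk; rewrite /entropy_rate ifF ?ltry//; apply/negbTE/asboolP.
by move/(_ k); rewrite leNgt yk.
Qed.

(** Stated on the raw counts, so that it also contains the outcomes where the counts are not
    summable and [scaled_seq] takes its default value. *)
Let escape b N : set (T N) :=
  [set t | exists n, b * V N <= \sum_(0 <= k < n) w k * (X N k t)%:R].
Arguments escape : clear implicits.

Let scaled_in b N t : (0 < N)%N -> ~ escape b N t ->
  weight_ball w b (scaled_seq (V N) (X N ^~ t)) /\
  (scaled_seq (V N) (X N ^~ t) : nat -> R) = fun k => (X N k t)%:R / V N.
Proof.
move=> N0 /forallNP h.
have V0 := V_gt0 N0.
have h' n : \sum_(0 <= k < n) w k * ((X N k t)%:R / V N) <= b.
  under eq_bigr do rewrite mulrA.
  by rewrite -mulr_suml ler_pdivrMr// leNgt; apply/negP => /ltW; exact: h.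
have x0 k : 0 <= (X N k t)%:R / V N by rewrite divr_ge0// ltW.
have E : (scaled_seq (V N) (X N ^~ t) : nat -> R) = fun k => (X N k t)%:R / V N.
  apply: (@scaled_seq_val _ _ _ (b / c)) => n.
  rewrite (eq_bigr (fun k => (X N k t)%:R / V N)); last by move=> k _; rewrite ger0_norm.
  exact: (weighted_tail_le c0 w_ge0 (fun k _ => cw k) x0 (h' n)).
by split => //; split; rewrite E.
Qed.

Let escape_measurable b N : measurable (escape b N).
Proof.
rewrite (_ : escape b N = \bigcup_n
    [set t | b * V N <= \sum_(0 <= k < n) w k * (X N k t)%:R]); last first.
  by apply/seteqP; split => t [n]; exists n.
by apply: bigcupT_measurable => n; exact: measurable_counts_ge.
Qed.

Let r0 N (N0 : (0 < N)%N) k : 0 <= V N * a N k.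
Proof. by rewrite mulr_ge0 ?a0// ltW// V_gt0. Qed.

Let chernoff N (N0 : (0 < N)%N) n (theta : nat -> R) b :
  (P N [set t | (b <= \sum_(0 <= k < n) theta k * (X N k t)%:R)%R]
   <= (expR (\sum_(0 <= k < n) V N * a N k * (expR (theta k) - 1) - b))%:E)%E.
Proof.
apply: (@poisson_chernoff _ _ _ _ _ (fun k => V N * a N k)).
- exact: mX.
- exact: iX.
- exact: r0.
- by move=> k A; exact: XP.
Qed.

Let point_ge N (N0 : (0 < N)%N) K (m : nat -> nat) s :
  (forall k, (K <= k)%N -> m k = 0%N) ->
  (forall n, \sum_(K <= k < n) V N * a N k <= s) ->
  (\prod_(0 <= k < K) poisson_prob (V N * a N k) 0 [set m k] * (expR (- s))%:E
   <= P N (\bigcap_k (X N k @^-1` [set m k])))%E.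
Proof.
apply: (@poisson_point_ge _ _ _ _ _ (fun k => V N * a N k)).
- exact: mX.
- exact: iX.
- exact: r0.
- by move=> k A; exact: XP.
Qed.

(** Exponential tightness: Chernoff with theta = w, where a <= C q and the moment bound S give a
    bound uniform in n, followed by n -> oo. *)
Let escape_le b : \forall N \near \oo,
  (P N (escape (C * S + b) N) <= (expR (V N * - b))%:E)%E.
Proof.
near=> N.
have N0 : (0 < N)%N by near: N.
have V0 := V_gt0 N0.
pose F n := [set t | (C * S + b) * V N <= \sum_(0 <= k < n) w k * (X N k t)%:R].
have mF n : measurable (F n) by exact: measurable_counts_ge.
have FE : \bigcup_n F n = escape (C * S + b) N.
  by apply/seteqP; split => t [n]; exists n.
have cvgP : (P N \o F) n @[n --> \oo] --> P N (escape (C * S + b) N).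
  rewrite -FE; apply: nondecreasing_cvg_mu => //.
    exact: bigcupT_measurable.
  move=> m n mn; apply/subsetPset => t /le_trans; apply.
  rewrite (big_cat_nat (leq0n m) mn)/= lerDl sumr_ge0// => k _.
  by rewrite mulr_ge0.
rewrite -(cvg_lim _ cvgP)//; apply: lime_le.
  by apply/cvg_ex; eexists; exact: cvgP.
apply: nearW => n /=.
apply: (le_trans (chernoff N0 n w _)).
rewrite lee_fin ler_expR.
under eq_bigr do rewrite -mulrA.
rewrite -mulr_sumr mulrC -mulrBl mulrC ler_pM2l//.
rewrite opprD addrA -[leRHS]add0r lerD2r subr_le0.
apply: (@le_trans _ _ (C * \sum_(0 <= k < n) q k * expR (w k))); last by rewrite ler_pM2l.
have aCN : forall k, a N k <= C * q k by near: N.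
rewrite mulr_sumr; apply: ler_sum => k _; rewrite mulrA.
apply: ler_pM => //; first exact: a0.
  by rewrite subr_ge0 -expR0 ler_expR.
by rewrite gerBl.
Unshelve. all: by end_near. Qed.

Let halfspace_le (b1 b2 : R) i : b1 < b2 -> \forall N \near \oo,
  (P N [set t | (V N * (b2 + dual i.1 i.2)
     <= \sum_(0 <= k < i.1) i.2 k * (X N k t)%:R)%R] <= (expR (V N * - b1))%:E)%E.
Proof.
case: i => n theta /= b12; near=> N.
have N0 : (0 < N)%N by near: N.
have V0 := V_gt0 N0.
apply: (le_trans (chernoff N0 n theta _)).
rewrite lee_fin ler_expR.
under eq_bigr do rewrite -mulrA.
rewrite -mulr_sumr -mulrBr ler_pM2l//.
suff : \sum_(0 <= k < n) a N k * (expR (theta k) - 1) <= dual n theta + (b2 - b1) by lra.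
near: N.
have cv : (\sum_(0 <= k < n) a N k * (expR (theta k) - 1)) @[N --> \oo] --> dual n theta.
  rewrite /dual; elim: n => [|n IH].
    rewrite big_geq//.
    rewrite (_ : (fun _ => _) = cst 0); first exact: cvg_cst.
    by apply/funext => N; rewrite big_geq.
  rewrite big_nat_recr//=.
  rewrite (_ : (fun N => _) = (fun N => \sum_(0 <= k < n) a N k * (expR (theta k) - 1)) \+
    (fun N => a N n * (expR (theta n) - 1))); last by apply/funext => N; rewrite big_nat_recr.
  by apply: cvgD => //; apply: cvgM => //; exact: cvg_cst.
have b0 : 0 < b2 - b1 by rewrite subr_gt0.
move/cvgrPdist_le : cv => /(_ _ b0); apply: filterS => N.
by rewrite ler_distl; lra.
Unshelve. all: by end_near. Qed.

Lemma poisson_ldp_upper (F : set (l1 R)) : closed F ->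
  (limn_esup (fun N => ((V N)^-1)%:E * lne (nu N F))
   <= - ereal_inf (entropy_rate q @` F))%E.
Proof.
move=> clF; apply: lee_oppr_dense => c1 c2 c12 c2F.
(* The loss from c2 to c3 pays for the convergence of the weights in the Chernoff bounds, the one
   from c3 to c1 for the number of half-spaces. *)
pose c3 := (c1 + c2) / 2.
have [c13 c32] : c1 < c3 /\ c3 < c2 by rewrite /c3; split; lra.
(* With this radius the escape probability is at most e^(- V c2). *)
pose b := C * S + c2.
pose K := weight_ball w b `&` F.
have cK : compact K by apply: compact_closedI => //; exact: weight_ball_compact c0 cw woo.
have KH : K `<=` cover setT (halfspace c2).
  move=> x [[x0 xb] Fx].
  have Ix : (c2%:E < entropy_rate q x)%E.
    by apply: lt_le_trans c2F _; apply: ereal_inf_lbound; exists x.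
  have [n [theta h]] := entropy_rate_dual q0 x0 Ix.
  by exists (n, theta) => //; rewrite /halfspace/= /dual -sumrB.
move: cK; rewrite compact_cover => /(_ _ setT (halfspace c2)).
case=> // D _ KD.
have [s Ks] : exists s : seq (nat * (nat -> R)), K `<=` cover [set` s] (halfspace c2).
  by exists (finmap.enum_fset D) => x /KD[i iD]; exists i.
pose H N (i : nat * (nat -> R)) := [set t | V N * (c2 + dual i.1 i.2)
     <= \sum_(0 <= k < i.1) i.2 k * (X N k t)%:R].
have mH N i : measurable (H N i) by exact: measurable_counts_ge.
have Hs : \forall N \near \oo, forall i, i \in s -> (P N (H N i) <= (expR (V N * - c3))%:E)%E.
  elim: (s) => [|i s' IH]; first exact: nearW.
  apply: filterS2 IH (halfspace_le i c32) => N IH Hi j.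
  by rewrite inE => /predU1P[->|/IH].
apply: limn_esup_near_le; near=> N.
have N0 : (0 < N)%N by near: N.
have V0 := V_gt0 N0.
apply: lne_le_expR => //.
apply: (@le_trans _ _ (P N (escape b N `|` \big[setU/set0]_(i <- s) H N i))).
  apply: le_measure; rewrite ?inE.
  - exact: measurable_scaled_seq.
  - by apply: measurableU => //; exact: bigsetU_measurable.
  - move=> t /= Ft; have [|nesc] := pselect (escape b N t); first by left.
    right; have [Kt Et] := scaled_in N0 nesc.
    have [i /= si] := Ks _ (conj Kt Ft).
    rewrite /halfspace/= Et => hi.
    rewrite -bigcup_seq; exists i => //=; rewrite /H/=.
    rewrite mulrC -ler_pdivlMr// mulr_suml.
    under eq_bigr do rewrite -mulrA.
    by rewrite -lerBrDr ltW.
apply: (@le_trans _ _ ((expR (V N * - c3))%:E + ((size s)%:R * expR (V N * - c3))%:E)%E).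
  apply: (le_trans (measureU2 _ _ _)) => //; first exact: bigsetU_measurable.
  apply: leeD.
    apply: (@le_trans _ _ (expR (V N * - c2))%:E); last first.
      by rewrite lee_fin ler_expR ler_pM2l// lerN2 ltW.
    by near: N; exact: escape_le.
  by apply: measure_bigsetU_le => //; near: N.
rewrite -EFinD lee_fin -{1}[expR _]mul1r -mulrDl.
rewrite -ler_pdivlMr ?expR_gt0// -expRB.
have -> : V N * - c1 - V N * - c3 = V N * (c3 - c1) by ring.
(* The union has [size s] half-spaces and one escape event; their number is eventually below e^(V
   (c3 - c1)). *)
have : 1 + (size s)%:R <= V N * (c3 - c1).
  rewrite -ler_pdivrMr ?subr_gt0//; apply/ltW.
  by near: N; exact: V_gt.
move=> /le_trans; apply; apply: le_trans (expR_ge1Dx _).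
by rewrite lerDr.
Unshelve. all: by end_near. Qed.

Lemma poisson_ldp_lower (G : set (l1 R)) : open G ->
  (- ereal_inf (entropy_rate q @` G)
   <= limn_einf (fun N => ((V N)^-1)%:E * lne (nu N G)))%E.
Proof.
move=> oG; rewrite leeNl; apply: le_ereal_inf_tmp => _ [x Gx <-]; rewrite leeNl.
have [Ioo|] := eqVneq (entropy_rate q x) +oo%E; first by rewrite Ioo leNye.
rewrite -ltey => Ioo.
have x0 k : 0 <= x k.
  by move: Ioo; rewrite /entropy_rate; case: ifPn => [/asboolP/(_ k)//|]; rewrite ltxx.
have Ifin : entropy_rate q x \is a fin_num by rewrite ge0_fin_numE// entropy_rate_ge0.
apply/lee_subgt0Pr => e e0; rewrite -(fineK Ifin) -EFinN -EFinB.
have Isum K : \sum_(0 <= k < K) poisson_rate (q k) (x k) <= fine (entropy_rate q x).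
  rewrite -lee_fin fineK// -sumEFin /entropy_rate ifT; last exact/asboolP.
  by apply: nneseries_lim_ge => k _ _; rewrite lee_fin poisson_rate_ge0.
have /nbhs_ballP[r /= r0' rG] : nbhs x G by apply: open_nbhs_nbhs.
have qS n : \sum_(0 <= k < n) q k <= S.
  apply: le_trans (qw n); apply: ler_sum => k _.
  by rewrite -[leLHS]mulr1 ler_pM2l// -expR0 ler_expR.
have xS n : \sum_(0 <= k < n) x k <= `|x|.
  apply: le_trans (l1_partial_sum_le x n); apply: ler_sum => k _; exact: ler_norm.
have eC : 0 < e / 2 / C by rewrite !divr_gt0.
have r4 : 0 < r / 4 by rewrite divr_gt0.
near \oo => K.
(* [K] makes two tails small: that of [q], the cost of having no count beyond [K], and that of [x],
   the norm error made by these zeros. *)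
have qK n : \sum_(K <= k < n) q k <= e / 2 / C.
  by move: n; near: K; exact: nonneg_tail_le (fun k => ltW (q0 k)) qS eC.
have xK n : \sum_(K <= k < n) x k <= r / 4.
  by move: n; near: K; exact: nonneg_tail_le x0 xS r4.
(* The K point estimates together lose at most e / 2; the other half of e goes to the vanishing
   counts. *)
pose delta := e / 2 / K.+1%:R.
have delta0 : 0 < delta by rewrite !divr_gt0.
pose m N k := if (k < K)%N then Num.truncn (V N * x k) else 0%N.
have points : \forall N \near \oo, forall k, (k < K)%N ->
    ((expR (- (V N * (poisson_rate (q k) (x k) + delta))))%:E
     <= poisson_prob (V N * a N k) 0 [set m N k])%E.
  have h : \forall N \near \oo, forall k : 'I_K,
    ((expR (- (V N * (poisson_rate (q k) (x k) + delta))))%:E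
     <= poisson_prob (V N * a N k) 0 [set Num.truncn (V N * x k)])%E.
    by apply: filter_forall => k; exact: poisson_point_near.
  apply: filterS h => N h k kK; rewrite /m kK; exact: (h (Ordinal kK)).
apply: limn_einf_near_ge; near=> N.
have N0 : (0 < N)%N by near: N.
have V0 := V_gt0 N0.
apply: expR_le_lne => //.
(* Rounding costs at most 1 / V per coordinate below [K], hence at most r / 4 in all for large N;
   the discarded tail of [x] is at most another r / 4. *)
have mG t : (\bigcap_k (X N k @^-1` [set m N k])) t ->
    G (scaled_seq (V N) (X N ^~ t)).
  move=> Xm; have -> : X N ^~ t = m N by apply/funext => k; exact: Xm.
  have vE : (scaled_seq (V N) (m N) : nat -> R) = fun k => (m N k)%:R / V N.
    apply: (@scaled_seq_val _ _ _ `|x|) => n.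
    apply: le_trans (l1_partial_sum_le x n); apply: ler_sum => k _.
    rewrite !ger0_norm ?divr_ge0 ?(ltW V0)// ler_pdivrMr// mulrC /m.
    by case: ifP => _; [rewrite truncn_le mulr_ge0 ?(ltW V0)|rewrite mulr_ge0 ?(ltW V0)].
  apply: rG; rewrite -ball_normE /=.
  set z := scaled_seq _ _ in vE *.
  have xz k : l1val (x - z) k = x k - (m N k)%:R / V N.
    by rewrite -[LHS]/(x k - z k) vE.
  apply: (@le_lt_trans _ _ (r / 4 + r / 4)); last by lra.
  apply: (@l1_norm_le _ (x - z) K) => n Kn; rewrite (big_cat_nat (leq0n K) Kn)/= lerD//.
    apply: (@le_trans _ _ (\sum_(0 <= k < K) (V N)^-1)).
      apply: ler_sum_nat => k /andP[_ kK]; rewrite [X in `|X| <= _](xz k) /m kK /=.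
      have /andP[t1 t2] := truncn_itv (mulr_ge0 (ltW V0) (x0 k)).
      rewrite ler_distl; apply/andP; split.
        rewrite lerBlDr; apply: (@le_trans _ _ (x k)) => //.
          by rewrite ler_pdivrMr// [leRHS]mulrC.
        by rewrite lerDl invr_ge0 ltW.
      by rewrite -[X in _ + X]mul1r -mulrDl natr1 ler_pdivlMr// [leLHS]mulrC ltW.
    rewrite sumr_const_nat subn0 -[leLHS]mulr_natl ler_pdivrMr// -ler_pdivrMl//.
    by apply/ltW; near: N; exact: V_gt.
  apply: le_trans (xK n); apply: ler_sum_nat => k /andP[Kk _].
  by rewrite [X in `|X| <= _](xz k) /m ltnNge Kk/= mul0r subr0 ger0_norm.
apply: (@le_trans _ _ (P N (\bigcap_k (X N k @^-1` [set m N k])))); last first.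
  apply: le_measure; rewrite ?inE.
  - by apply: bigcapT_measurable => k; exact: measurable_preimage_nat.
  - exact: measurable_scaled_seq.
  - by move=> t; exact: mG.
have aCN : forall k, a N k <= C * q k by near: N.
have tail n : \sum_(K <= k < n) V N * a N k <= V N * (e / 2).
  rewrite -mulr_sumr ler_pM2l// (@le_trans _ _ (C * \sum_(K <= k < n) q k))//.
    by rewrite mulr_sumr; apply: ler_sum => k _.
  by rewrite mulrC -ler_pdivlMr.
have mK k : (K <= k)%N -> m N k = 0%N by move=> Kk; rewrite /m ltnNge Kk.
apply: (le_trans _ (point_ge N0 mK tail)).
apply: (@le_trans _ _ ((\prod_(0 <= k < K)
    (expR (- (V N * (poisson_rate (q k) (x k) + delta))))%:E)
    * (expR (- (V N * (e / 2))))%:E)%E).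
  rewrite prodEFin -expR_sum -EFinM -expRD lee_fin ler_expR.
  rewrite sumrN -mulr_sumr big_split/= sumr_const_nat subn0.
  set h := \sum_(0 <= k < K) _.
  have -> : - (V N * (h + delta *+ K)) - V N * (e / 2)
      = V N * - (h + delta *+ K + e / 2) by rewrite mulrN -opprD -mulrDr.
  rewrite ler_pM2l// lerNr opprD !opprK.
  have : delta *+ K <= e / 2.
    rewrite /delta -[leLHS]mulr_natr -[e / 2 / _ * _]mulrA.
    apply: ler_piMr; first by rewrite divr_ge0 ?ltW.
    by rewrite mulrC ler_pdivrMr// mul1r ler_nat.
  have := Isum K; rewrite -/h; lra.
apply: lee_pmul => //; first by apply: prode_ge0 => k _; rewrite lee_fin expR_ge0.
have ptsN : forall k, (k < K)%N ->
    ((expR (- (V N * (poisson_rate (q k) (x k) + delta))))%:E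
     <= poisson_prob (V N * a N k) 0 [set m N k])%E by near: N.
rewrite [leLHS]big_nat [leRHS]big_nat; apply: lee_prod => k /= kK.
by rewrite lee_fin expR_ge0/=; exact: ptsN.
Unshelve. all: by end_near. Qed.

Lemma poisson_ldp : LDP V nu (entropy_rate q : l1 R -> \bar R).
Proof.
split.
- by move=> x; exact: entropy_rate_ge0.
- exact: entropy_rate_lsc.
- exact: poisson_ldp_upper.
- exact: poisson_ldp_lower.
Qed.

End poisson_ldp.

(** * Free cycle weights *)

Section cycle_weight_facts.
Context {R : realType}.
Variables (d : nat) (beta mu : R).
Hypotheses (hd : (0 < d)%N) (hbeta : 0 < beta) (hmu : mu <= 0).

Lemma q_gt0 k : 0 < q d beta mu k.+1.
Proof.
rewrite /q divr_gt0 ?expR_gt0// mulr_gt0// powR_gt0 ?ltr0n//.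
by rewrite !mulr_gt0 ?pi_gt0.
Qed.

(* Its exponential (k + 2) ^ (1 / 4) is small enough for the moment
   [cycle_weight_moment] to be finite in every dimension. *)
Definition cycle_moment_weight (k : nat) : R := ln k.+2%:R / 4.

Lemma cycle_moment_weight_ge k : ln 2 / 4 <= cycle_moment_weight k.
Proof. by rewrite ler_pM2r// ler_ln ?posrE ?ltr0n// ler_nat. Qed.

Lemma cycle_moment_weight_cvg : cycle_moment_weight @ \oo --> +oo.
Proof.
apply/cvgryPge => A; near=> k.
rewrite ler_pdivlMr// -(expRK (A * 4)) ler_ln ?posrE ?expR_gt0 ?ltr0n//.
apply: (@le_trans _ _ k%:R); last by rewrite ler_nat -addn2 leq_addr.
near: k; exact: nbhs_infty_ger.
Unshelve. all: by end_near. Qed.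

Let root4 (k : nat) : R := k%:R `^ 4^-1.

Let root4X k : root4 k ^+ 4 = k%:R.
Proof. by rewrite /root4 -powR_mulrn ?powR_ge0// -powRrM mulVf// powRr1. Qed.

Let root4_gt0 k : 0 < root4 k.+1.
Proof. by rewrite powR_gt0// ltr0n. Qed.

(** With a, b the fourth roots of k + 1, k + 2, the identity b^4 - a^4 = 1 gives 1 <= 4 b^3 (b - a),
    so 1/a - 1/b >= 1 / (4 b^5). This makes the series of (k + 2)^(-5/4) telescope. *)
Let inv_root4_sub k : (root4 k.+2 ^+ 5)^-1 <= 4 * ((root4 k.+1)^-1 - (root4 k.+2)^-1).
Proof.
have a0 := root4_gt0 k; have b0 := root4_gt0 k.+1.
have ha := root4X k.+1; have hb := root4X k.+2.
set a := root4 k.+1 in a0 ha *; set b := root4 k.+2 in b0 hb *.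
have ab4 : b ^+ 4 - a ^+ 4 = 1 by rewrite ha hb -natrB// subSnn.
have ab : a < b.
  rewrite -(@ltr_pXn2r _ 4)// ?nnegrE ?ltW//.
  by rewrite -subr_gt0 ab4.
have -> : 4 * (a^-1 - b^-1) = 4 * (b - a) / (a * b) by field; rewrite !gt_eqF.
rewrite ler_pdivlMr ?mulr_gt0// mulrC ler_pdivrMr ?exprn_gt0//.
have : 1 <= (b - a) * (4 * b ^+ 3).
  rewrite [X in X <= _](_ : _ = (b - a) * ((b + a) * (b ^+ 2 + a ^+ 2))); last first.
    by rewrite -[LHS]ab4; ring.
  rewrite ler_pM2l ?subr_gt0//.
  have h1 : b + a <= 2 * b by lra.
  have h2 : b ^+ 2 + a ^+ 2 <= 2 * b ^+ 2.
    have : a ^+ 2 <= b ^+ 2 by rewrite ler_pXn2r// ?nnegrE ltW.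
    by lra.
  have -> : 4 * b ^+ 3 = (2 * b) * (2 * b ^+ 2) by ring.
  by apply: ler_pM => //; rewrite addr_ge0 ?sqr_ge0 ?ltW.
have : a * b <= b ^+ 2 by rewrite expr2 ler_pM2r// ltW.
have b2 : 0 < b ^+ 2 by rewrite exprn_gt0.
move=> h1 h2; apply: (le_trans h1).
have -> : 4 * (b - a) * b ^+ 5 = b ^+ 2 * ((b - a) * (4 * b ^+ 3)) by ring.
by rewrite -[leLHS]mulr1 ler_pM2l.
Qed.

(** As mu <= 0 and d >= 1, the weight of length k + 1 is at most c (k + 1)^(-3/2). The factor (k +
    2)^(1/4) leaves order k^(-5/4), which is summable. *)
Lemma cycle_weight_moment : exists S : R, forall n,
  \sum_(0 <= k < n) q d beta mu k.+1 * expR (cycle_moment_weight k) <= S.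
Proof.
pose c := ((4 * pi * beta) `^ (d%:R / 2))^-1.
have pb0 : 0 < 4 * pi * beta by rewrite !mulr_gt0 ?pi_gt0.
have c0 : 0 < c by rewrite invr_gt0 powR_gt0.
have qle k : q d beta mu k.+1 <= c * (root4 k.+1 ^+ 6)^-1.
  rewrite /q invfM mulrA -/c [leRHS](_ : _ = 1 * c * (root4 k.+1 ^+ 6)^-1) ?mul1r//.
  have -> : root4 k.+1 ^+ 6 = k.+1%:R `^ (1 + 1 / 2).
    rewrite /root4 -powR_mulrn ?powR_ge0// -powRrM; congr (_ `^ _).
    by lra.
  apply: ler_pM.
  - by rewrite mulr_ge0 ?expR_ge0// ltW.
  - by rewrite invr_ge0 powR_ge0.
  - rewrite -[leRHS]mul1r ler_pM2r// -expR0 ler_expR.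
    by rewrite mulr_le0_ge0// mulr_ge0_le0// ltW.
  - rewrite lef_pV2 ?posrE ?powR_gt0 ?ltr0n//.
    rewrite ler_powR ?ler1n// lerD2l ler_pM2r// ler1n//.
exists (c * 64 * 4) => n.
(* The factor 64 = 2^6 pays for replacing the fourth root of k + 1 by that of k + 2 in the sixth
   power; the factor 4 comes from the telescoping bound. *)
have step k : q d beta mu k.+1 * expR (cycle_moment_weight k)
    <= c * 64 * 4 * ((root4 k.+1)^-1 - (root4 k.+2)^-1).
  have -> : expR (cycle_moment_weight k) = root4 k.+2.
    by rewrite /cycle_moment_weight /root4 /powR gt_eqF ?ltr0n// mulrC.
  have a0 := root4_gt0 k; have b0 := root4_gt0 k.+1.
  apply: (@le_trans _ _ (c * (root4 k.+1 ^+ 6)^-1 * root4 k.+2)).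
    by rewrite ler_pM2r.
  rewrite -[leRHS]mulrA; apply: (@le_trans _ _ (c * 64 * (root4 k.+2 ^+ 5)^-1)); last first.
    by apply: ler_wpM2l (inv_root4_sub k); rewrite mulr_ge0// ltW.
  rewrite -!mulrA ler_pM2l//.
  have ba : root4 k.+2 <= 2 * root4 k.+1.
    rewrite -(@ler_pXn2r _ 4)// ?nnegrE ?mulr_ge0 ?ltW// exprMn !root4X.
    rewrite -!natr1; have : (0 : R) <= k%:R by [].
    by lra.
  rewrite -[64](_ : 2 ^+ 6 = _); last by rewrite -natrX.
  rewrite ler_pdivrMl ?exprn_gt0// mulrA ler_pdivlMr ?exprn_gt0//.
  have : root4 k.+2 ^+ 6 <= (2 * root4 k.+1) ^+ 6.
    by apply: lerXn2r; rewrite ?nnegrE ?mulr_ge0// ltW.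
  by rewrite -exprS exprMn mulrC.
apply: (@le_trans _ _ (\sum_(0 <= k < n) c * 64 * 4 *
   ((root4 k.+1)^-1 - (root4 k.+2)^-1))); first exact: ler_sum.
rewrite -mulr_sumr -[leRHS]mulr1 ler_pM2l ?mulr_gt0//.
have -> : \sum_(0 <= k < n) ((root4 k.+1)^-1 - (root4 k.+2)^-1) = 1 - (root4 n.+1)^-1.
  elim: n => [|n IH]; first by rewrite big_geq// /root4 powR1 invr1 subrr.
  by rewrite big_nat_recr//= IH; ring.
by rewrite gerBl invr_ge0 ltW.
Qed.

Lemma qbar_lty : (qbar d beta mu < +oo)%E.
Proof.
have [S hS] := cycle_weight_moment; apply: (@le_lt_trans _ _ S%:E); last exact: ltry.
apply: lime_le.
  by apply: is_cvg_nneseries => k _ _; rewrite lee_fin ltW// q_gt0.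
apply: nearW => n; rewrite sumEFin lee_fin; apply: le_trans (hS n).
apply: ler_sum => k _; rewrite -[leLHS]mulr1 ler_pM2l ?q_gt0//.
rewrite -expR0 ler_expR; apply: le_trans (cycle_moment_weight_ge k).
by rewrite divr_ge0// ln_ge0// ler1n.
Qed.

End cycle_weight_facts.

(** * Periodic boundary conditions *)

Section lattice_sum.
Context {R : realType}.

Lemma le_esumZ (T : choiceType) (S : set T) (c : R) (f : T -> \bar R) : 0 <= c ->
  (forall x, 0 <= f x)%E ->
  (\esum_(x in S) (c%:E * f x) <= c%:E * \esum_(x in S) f x)%E.
Proof.
move=> c0 f0; apply: ge_ereal_sup => _ [A [fA AS] <-].
rewrite -ge0_mule_fsumr// lee_wpmul2l ?lee_fin//.
by apply: ereal_sup_ubound; exists A.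
Qed.

(** Tonelli for sums over the integer lattice, splitting off the first coordinate. *)
Lemma esum_rV_prod_le d (g : int -> R) (M : R) : (forall j, 0 <= g j) -> 0 <= M ->
  (\esum_(j in [set: int]) (g j)%:E <= M%:E)%E ->
  (\esum_(z in [set: 'rV[int]_d]) (\prod_(i < d) g (z 0 i))%:E <= (M ^+ d)%:E)%E.
Proof.
move=> g0 M0 gM; elim: d => [|d IH].
  rewrite (_ : [set: 'rV[int]_0] = [set 0]); last first.
    by apply/seteqP; split => // z _; exact: thinmx0.
  by rewrite esum_set1 ?big_ord0 ?expr0// lee_fin.
pose e (p : int * 'rV[int]_d) : 'rV[int]_d.+1 := row_mx ((p.1)%:M : 'M[int]_1) p.2.
have ebij : set_bij [set: int * 'rV[int]_d] [set: 'rV[int]_d.+1] e.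
  split => //.
  - move=> [a u] [b v] _ _ /rowP h; congr pair.
      by have := h ord0; rewrite !row_mx_scalar0.
    by apply/rowP => i; have := h (lift ord0 i); rewrite !row_mx_scalarS.
  - move=> z _; exists (z 0 ord0, \row_i z 0 (lift ord0 i)) => //.
    apply/rowP => i; case: (unliftP ord0 i) => [j|] ->.
      by rewrite row_mx_scalarS mxE.
    by rewrite row_mx_scalar0.
rewrite (reindex_esum _ _ _ _ ebij).
pose F i (v : 'rV[int]_d) := ((g i)%:E * (\prod_(j < d) g (v 0 j))%:E)%E.
have p0 (v : 'rV[int]_d) : 0 <= \prod_(j < d) g (v 0 j) by exact: prodr_ge0.
have F0 i v : (0 <= F i v)%E by rewrite /F -EFinM lee_fin mulr_ge0.
have -> : \esum_(p in [set: int * 'rV[int]_d]) (\prod_(i < d.+1) g (e p 0 i))%:E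
    = \esum_(i in [set: int]) \esum_(v in [set: 'rV[int]_d]) F i v.
  rewrite esum_esum; last by move=> *; exact: F0.
  rewrite (_ : setXR _ _ = [set: int * 'rV[int]_d]); last by apply/seteqP; split.
  apply: eq_esum => -[i v] _; rewrite big_ord_recl row_mx_scalar0 /F -EFinM.
  by congr (_ * _)%:E; apply: eq_bigr => j _; rewrite row_mx_scalarS.
apply: (@le_trans _ _ (\esum_(i in [set: int]) ((M ^+ d)%:E * (g i)%:E))%E).
  apply: le_esum => i _; apply: (le_trans (le_esumZ _ _ _)) => //.
  by rewrite [leRHS]muleC lee_wpmul2l ?lee_fin.
apply: (le_trans (le_esumZ _ _ _)) => //; first exact: exprn_ge0.
by rewrite exprSr EFinM lee_wpmul2l// lee_fin exprn_ge0.
Qed.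

Let gauss (j : int) : R := expR (- (j%:~R ^+ 2)).

(** Since j^2 >= |j|, each half of the integers is dominated by a geometric series of ratio 1/e. *)
Lemma esum_gauss_int : exists2 M : R, 0 <= M &
  (\esum_(j in [set: int]) (gauss j)%:E <= M%:E)%E.
Proof.
pose z : R := expR (-1).
have z1 : z < 1 by rewrite -expR0 ltr_expR; lra.
have z0 : 0 < z by exact: expR_gt0.
pose B := (1 - z)^-1.
have B0 : 0 <= B by rewrite invr_ge0 subr_ge0 ltW.
have g0 j : (0 <= (gauss j)%:E)%E by rewrite lee_fin expR_ge0.
have half (e : nat -> int) : (forall n, n%:R <= (e n)%:~R ^+ 2 :> R) ->
    (\esum_(n in [set: nat]) (gauss (e n))%:E <= B%:E)%E.
  move=> en; rewrite -nneseries_esumT//; apply: lime_le.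
    by apply: is_cvg_nneseries.
  apply: nearW => n; rewrite sumEFin lee_fin.
  apply: (@le_trans _ _ (\sum_(0 <= k < n) z ^+ k)).
    apply: ler_sum => k _; rewrite /gauss /z -expRM_natr ler_expR mulN1r lerN2.
    exact: en.
  have := @geometric_seriesE R 1 z; rewrite lt_eqF// => /(_ isT) /(congr1 (fun f => f n)).
  rewrite /series/= => h.
  rewrite (eq_bigr (fun k => 1 * z ^+ k)); last by move=> k _; rewrite mul1r.
  rewrite h mul1r -[leRHS]mul1r; apply: ler_wpM2r => //.
  by rewrite gerBl exprn_ge0 ?ltW.
exists (B + B); first exact: addr_ge0.
rewrite (esumID (range Posz)) => [|j _]; last exact: g0.
rewrite !setTI EFinD; apply: leeD.
  rewrite (reindex_esum [set: nat] _ Posz); last first.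
    split; [by move=> n _; exists n|by move=> m n _ _ []|].
    by move=> _ [n _ <-]; exists n.
  apply: half => n; rewrite -natrX ler_nat.
  by case: n => // n; rewrite expnS leq_pmulr// expn1.
rewrite (reindex_esum [set: nat] _ Negz); last first.
  split; [by move=> n _ [m]|by move=> m n _ _ []|].
  by move=> [n|n] h; [exfalso; apply: h; exists n|exists n].
apply: (half Negz) => n; rewrite NegzE mulrNz sqrrN -natrX ler_nat.
by apply: (@leq_trans n.+1) => //; rewrite expnS leq_pmulr// expn1.
Qed.

End lattice_sum.

Section periodic.
Context {R : realType}.
Variable d : nat.
Implicit Types (t : R) (N : nat).

(** The value of the free heat kernel on the diagonal. *)
Definition heat_peak t : R := (4 * pi * t) `^ (- (d%:R / 2)).

Lemma heat_peak_gt0 t : 0 < t -> 0 < heat_peak t.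
Proof. by move=> t0; rewrite powR_gt0// !mulr_gt0// pi_gt0. Qed.

(** The image z = 0 gives the peak. For z <> 0 put s = N^2 / t; since s and |z|^2 are at least 1, s
    |z|^2 >= s + |z|^2 - 1, which separates e^(1 - s) from a lattice sum independent of t, N and
    x. *)
Lemma heat_kernel_per_diag : exists2 M : R, 0 <= M & forall t N (x : 'rV[R]_d),
  0 < t -> t <= N%:R ^+ 2 ->
  ((heat_peak t)%:E <= heat_kernel_per N t x x
   <= (heat_peak t * (1 + expR (1 - N%:R ^+ 2 / t) * M))%:E)%E.
Proof.
have [M0 M00 gM] := @esum_gauss_int R.
exists (M0 ^+ d) => [|t N x t0 tN]; first exact: exprn_ge0.
pose sq (z : 'rV[int]_d) : R := \sum_(i < d) (z 0 i)%:~R ^+ 2.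
have hE z : heat_kernel t x (x + (2 * N%:R) *: map_mx intr z)
    = heat_peak t * expR (- (N%:R ^+ 2 / t * sq z)).
  rewrite /heat_kernel -/(heat_peak t); congr (_ * expR (- _)).
  rewrite /sq_dist (eq_bigr (fun i => 4 * N%:R ^+ 2 * (z 0 i)%:~R ^+ 2)); last first.
    by move=> i _; rewrite !mxE; ring.
  by rewrite -mulr_sumr -/(sq z); field; rewrite gt_eqF.
have p0 := heat_peak_gt0 t0.
rewrite /heat_kernel_per; under eq_esum do rewrite hE.
rewrite (esumID [set 0]) => [|z _]; last by rewrite lee_fin mulr_ge0 ?expR_ge0// ltW.
have sq0 : sq 0 = 0 by rewrite /sq big1// => i _; rewrite mxE expr0n.
rewrite !setTI esum_set1; last by rewrite lee_fin mulr_ge0 ?expR_ge0// ltW.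
rewrite sq0 mulr0 oppr0 expR0 mulr1; apply/andP; split.
  by rewrite leeDl// esum_ge0// => z _; rewrite lee_fin mulr_ge0 ?expR_ge0// ltW.
rewrite mulrDr mulr1 EFinD leeD2l//.
set c := heat_peak t * expR (1 - N%:R ^+ 2 / t).
have c0 : 0 <= c by rewrite mulr_ge0 ?expR_ge0// ltW.
pose G (z : 'rV[int]_d) : R := \prod_(i < d) expR (- ((z 0 i)%:~R ^+ 2)).
have G0 z : 0 <= G z by apply: prodr_ge0 => i _; exact: expR_ge0.
have gE (z : 'rV[int]_d) : G z = expR (- sq z).
  by rewrite /G -expR_sum sumrN.
apply: (@le_trans _ _ (\esum_(z in ~` [set 0%R])
    (c%:E * (G z)%:E))%E).
  apply: le_esum => z /eqP z0; rewrite gE -EFinM lee_fin /c -[leRHS]mulrA ler_pM2l//.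
  rewrite -expRD ler_expR.
  have sq1 : 1 <= sq z.
    have [i zi] : exists i, z 0 i != 0.
      apply: contrapT => /forallNP h; move/eqP: z0; apply.
      by apply/rowP => i; rewrite mxE; apply/eqP; apply: contrapT => /negP; exact: h.
    rewrite /sq (bigD1 i)//= ler_wpDr ?sumr_ge0// => [j _|]; first exact: sqr_ge0.
    rewrite -rmorphXn/= -[1]/(1%:~R) ler_int.
    have : z 0 i ^+ 2 != 0 by rewrite sqrf_eq0.
    have : 0 <= z 0 i ^+ 2 by exact: sqr_ge0.
    by case: (z 0 i ^+ 2) => // -[].
  have s1 : 1 <= N%:R ^+ 2 / t by rewrite ler_pdivlMr// mul1r.
  by nra.
apply: (@le_trans _ _ (\esum_(z in [set: 'rV[int]_d])
    (c%:E * (G z)%:E))%E).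
  rewrite [leRHS](esumID (~` [set 0])) => [|z _]; last first.
    by rewrite -EFinM lee_fin mulr_ge0.
  rewrite setTI leeDl// esum_ge0// => z _.
  by rewrite -EFinM lee_fin mulr_ge0.
apply: (le_trans (le_esumZ _ _ _)) => //.
rewrite [leRHS](_ : _ = c%:E * (M0 ^+ d)%:E)%E; last by rewrite -EFinM /c mulrA.
rewrite lee_wpmul2l ?lee_fin//.
apply: (@esum_rV_prod_le _ d (fun j => expR (- (j%:~R ^+ 2)))) => //.
Qed.

End periodic.

(** * Averages over the box and the periodic weights *)

Section box_average.
Context {R : realType}.
Variables (d : nat).

Lemma box_cube N : @box R d N = cube (fun=> - N%:R) (fun=> N%:R).
Proof. by []. Qed.

Lemma integral_box_cst N (c : R) : 0 <= c ->
  integral_rV_on (@box R d N) (fun=> c%:E) = (c * box_vol R d N)%:E.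
Proof.
move=> c0; rewrite box_cube integral_rV_on_cube//; last first.
  by move=> _; rewrite (@le_trans _ _ 0)// oppr_le0.
by rewrite prodr_const card_ord /box_vol opprK mulr_natl mulr2n.
Qed.

Lemma fine_integral_box_bounds N (f : 'rV[R]_d -> \bar R) (lo hi : R) : 0 <= lo ->
  (forall x, box N x -> lo%:E <= f x <= hi%:E)%E ->
  lo * box_vol R d N <= fine (integral_rV_on (@box R d N) f) <= hi * box_vol R d N.
Proof.
move=> lo0 fb.
have b0 : @box R d N 0 by move=> i; rewrite mxE oppr_le0 !ler0n.
have hi0 : 0 <= hi.
  have /andP[h1 h2] := fb _ b0; rewrite -lee_fin.
  by rewrite (le_trans _ h2)// (le_trans _ h1)// lee_fin.
have lof x : box N x -> (0 <= f x)%E.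
  by move=> /fb/andP[h _]; rewrite (le_trans _ h)// lee_fin.
have Ilo : ((lo * box_vol R d N)%:E <= integral_rV_on (@box R d N) f)%E.
  rewrite -integral_box_cst//; apply: ge0_le_integral_rV_on => // x.
  by move=> /fb/andP[].
have Ihi : (integral_rV_on (@box R d N) f <= (hi * box_vol R d N)%:E)%E.
  rewrite -integral_box_cst//; apply: ge0_le_integral_rV_on => // x.
  by move=> /fb/andP[].
have If : integral_rV_on (@box R d N) f \is a fin_num.
  rewrite ge0_fin_numE ?(le_lt_trans Ihi) ?ltry//.
  by rewrite (le_trans _ Ilo)// lee_fin mulr_ge0// exprn_ge0// mulr_ge0.
by rewrite -!lee_fin fineK// Ilo Ihi.
Qed.

(** A kernel with constant diagonal value x times the free one has weight x times the free
    weight. *)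
Lemma cycle_weight_heat_peak (beta mu x v : R) (k : nat) : 0 < beta -> v != 0 ->
  expR (beta * mu * k.+1%:R) / (k.+1%:R * v) * (x * heat_peak d (k.+1%:R * beta) * v)
  = x * q d beta mu k.+1.
Proof.
move=> b0 v0; rewrite /q /heat_peak.
have k0 : (0 : R) < k.+1%:R by [].
have -> : 4 * pi * (k.+1%:R * beta) = (4 * pi * beta) * k.+1%:R by ring.
have pb0 : 0 < 4 * pi * beta by rewrite !mulr_gt0 ?pi_gt0.
rewrite powRM ?ltW// !powRN powRD; last by rewrite (gt_eqF k0) implybT.
rewrite powRr1 ?ltW//.
have h1 := powR_gt0 (d%:R / 2) pb0; have h2 := powR_gt0 (d%:R / 2) k0.
by field; rewrite v0 !gt_eqF.
Qed.

(** At time t = (k + 1) beta the cutoff k + 1 <= N yields N^2 / t >= N / beta, so the correction is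
    uniform in the cycle length. *)
Lemma q_bc_periodic (beta mu : R) (pDir : nat -> R -> 'rV[R]_d -> 'rV[R]_d -> R) :
    0 < beta -> exists2 M : R, 0 <= M &
  forall N k, (k < N)%N -> beta <= N%:R ->
    q d beta mu k.+1 <= q_bc beta mu pDir Periodic N k.+1
      <= (1 + expR (1 - N%:R / beta) * M) * q d beta mu k.+1.
Proof.
move=> b0; have [M M0 hM] := @heat_kernel_per_diag R d.
exists M => // N k kN bN; rewrite /q_bc kN.
have N0 : (0 : R) < N%:R by rewrite ltr0n (leq_ltn_trans _ kN).
have k0 : (0 : R) < k.+1%:R by [].
have t0 : 0 < k.+1%:R * beta by rewrite mulr_gt0.
have tN : k.+1%:R * beta <= N%:R ^+ 2.
  by rewrite expr2; apply: ler_pM => //; [exact: ltW|rewrite ler_nat].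
have v0 : 0 < box_vol R d N by rewrite exprn_gt0// mulr_gt0.
set I := fine _.
have p0 := heat_peak_gt0 d t0.
have /andP[I1 I2] : 1 * heat_peak d (k.+1%:R * beta) * box_vol R d N <= I
    <= (1 + expR (1 - N%:R / beta) * M) * heat_peak d (k.+1%:R * beta) * box_vol R d N.
  apply: fine_integral_box_bounds => [|x _]; first by rewrite mul1r ltW.
  have /andP[h1 h2] := hM _ _ x t0 tN.
  rewrite mul1r h1/=; apply: (le_trans h2).
  rewrite lee_fin [leRHS]mulrC ler_pM2l// lerD2l ler_wpM2r// ler_expR lerD2l lerN2.
  rewrite ler_pdivlMr//.
  have -> : N%:R / beta * (k.+1%:R * beta) = N%:R * k.+1%:R by field; rewrite gt_eqF.
  by rewrite expr2 ler_pM2l// ler_nat.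
have c0 : 0 < expR (beta * mu * k.+1%:R) / (k.+1%:R * box_vol R d N).
  by rewrite divr_gt0 ?expR_gt0// mulr_gt0.
have v1 : box_vol R d N != 0 by rewrite gt_eqF.
rewrite -{1}[q _ _ _ _]mul1r -!(cycle_weight_heat_peak mu _ _ b0 v1).
by rewrite !(ler_pM2l c0) I1 I2.
Qed.

End box_average.

(** * Brownian motion killed on leaving a box *)

Section gaussian_interval.
Context {R : realType}.
Implicit Types (u a b : R).

Definition gauss_peak u : R := (Num.sqrt (4 * pi * u))^-1.

Lemma gauss_peak_gt0 u : 0 < u -> 0 < gauss_peak u.
Proof. by move=> u0; rewrite invr_gt0 sqrtr_gt0 !mulr_gt0// pi_gt0. Qed.

Lemma gauss_peakX d u : 0 < u -> gauss_peak u ^+ d = heat_peak d u.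
Proof.
move=> u0; have pu : 0 < 4 * pi * u by rewrite !mulr_gt0// pi_gt0.
rewrite /gauss_peak /heat_peak -powR12_sqrt ?(ltW pu)// -powRN.
rewrite -powR_mulrn ?powR_ge0// -powRrM; congr (_ `^ _).
by rewrite mulNr mulrC.
Qed.

Lemma normal_pdf_gauss u x : 0 < u ->
  normal_pdf 0 (Num.sqrt (2 * u)) x = gauss_peak u * expR (- (x ^+ 2 / (4 * u))).
Proof.
move=> u0; have u2 : 0 < 2 * u by rewrite mulr_gt0.
rewrite normal_pdfE ?gt_eqF ?sqrtr_gt0//.
rewrite /normal_peak /normal_fun /gauss_peak sqr_sqrtr ?(ltW u2)// subr0.
congr ((Num.sqrt _)^-1 * expR _); first by rewrite -mulr_natl; ring.
by rewrite mulNr; congr (- (_ / _)); rewrite -mulr_natl; ring.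
Qed.

Lemma integral_itv_cst a b (c : R) : a <= b ->
  (\int[lebesgue_measure]_(x in `[a, b]) (c%:E) = (c * (b - a))%:E)%E.
Proof.
move=> ab; rewrite integral_cst//= lebesgue_measure_itv/= lte_fin.
case: ltP => [_|ba]; first by rewrite -EFinB -EFinM.
by rewrite mule0 (@le_anti _ _ a b) ?ab// subrr mulr0.
Qed.

Let mpdf u (D : set R) : measurable D ->
  measurable_fun D (fun x => (normal_pdf 0 (Num.sqrt (2 * u)) x)%:E).
Proof.
move=> mD; apply/measurable_EFinP; apply: measurable_funTS.
exact: measurable_normal_pdf.
Qed.

Lemma normal_prob_itv_le u a b rho : 0 < u -> a <= b -> 0 <= rho ->
  (forall x, a <= x <= b -> rho <= `|x|) ->
  (normal_prob 0 (Num.sqrt (2 * u)) [set` `[a, b]]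
   <= (gauss_peak u * expR (- (rho ^+ 2 / (4 * u))) * (b - a))%:E)%E.
Proof.
move=> u0 ab rho0 abr; rewrite -integral_itv_cst// /normal_prob.
apply: ge0_le_integral => //.
- by move=> x _; rewrite lee_fin normal_pdf_ge0.
- exact: mpdf.
- move=> x /=; rewrite in_itv/= => xab; rewrite lee_fin normal_pdf_gauss//.
  rewrite ler_pM2l ?gauss_peak_gt0// ler_expR lerN2 ler_pM2r ?invr_gt0 ?mulr_gt0//.
  by rewrite -[leRHS]real_normK ?num_real// ler_pXn2r ?nnegrE// abr.
Qed.

Lemma normal_prob_itv_ge u a b rho : 0 < u -> a <= b ->
  (forall x, a <= x <= b -> `|x| <= rho) ->
  ((gauss_peak u * expR (- (rho ^+ 2 / (4 * u))) * (b - a))%:E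
   <= normal_prob 0 (Num.sqrt (2 * u)) [set` `[a, b]])%E.
Proof.
move=> u0 ab abr; rewrite -integral_itv_cst// /normal_prob.
apply: ge0_le_integral => //.
- by move=> x _; rewrite lee_fin mulr_ge0 ?expR_ge0// ltW// gauss_peak_gt0.
- exact: mpdf.
- move=> x /=; rewrite in_itv/= => xab; rewrite lee_fin normal_pdf_gauss//.
  rewrite ler_pM2l ?gauss_peak_gt0// ler_expR lerN2 ler_pM2r ?invr_gt0 ?mulr_gt0//.
  rewrite -[leLHS]real_normK ?num_real// ler_pXn2r ?nnegrE// ?abr//.
  exact: le_trans (abr x xab).
Qed.

(** A bound, uniform over durations up to t, for the density of an increment of size r / 2; it tends
    to 0 as r grows. *)
Definition exit_bound d t r : R := (16 * d%:R * Num.sqrt t / r ^+ 2) ^+ d.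

Lemma exit_bound_ge0 d t r : 0 <= exit_bound d t r.
Proof. by rewrite exprn_ge0// divr_ge0 ?sqr_ge0// !mulr_ge0 ?sqrtr_ge0. Qed.

(** Share the exponent r^2 / (16 u) equally among the d factors, each with z = r^2 / (16 d u). Then
    e^(- z) <= 1 / z outweighs the singularity u^(-1/2) and leaves 16 d sqrt u / r^2, which
    increases with u. *)
Lemma exit_bound_ge d t u r : (0 < d)%N -> 0 < u -> u <= t -> 0 < r ->
  gauss_peak u ^+ d * expR (- ((r / 2) ^+ 2 / (4 * u))) <= exit_bound d t r.
Proof.
move=> d0 u0 ut r0; have d0' : (0 : R) < d%:R by rewrite ltr0n.
have r20 : 0 < r ^+ 2 by rewrite exprn_gt0.
pose z := r ^+ 2 / (16 * d%:R * u).
have z0 : 0 < z by rewrite divr_gt0// !mulr_gt0.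
have -> : - ((r / 2) ^+ 2 / (4 * u)) = - z * d%:R by rewrite /z; field; rewrite !gt_eqF.
rewrite expRM_natr -exprMn /exit_bound ler_pXn2r ?nnegrE//; last 2 first.
- by rewrite mulr_ge0 ?expR_ge0// ltW// gauss_peak_gt0.
- by apply: divr_ge0; [rewrite !mulr_ge0 ?sqrtr_ge0|exact: ltW].
have su : 0 < Num.sqrt u by rewrite sqrtr_gt0.
have gu : gauss_peak u <= (Num.sqrt u)^-1.
  rewrite /gauss_peak lef_pV2 ?posrE ?sqrtr_gt0 ?mulr_gt0 ?pi_gt0//.
  rewrite ler_wsqrtr// -[leLHS]mul1r ler_pM2r//.
  by have := pi_ge2 R; lra.
have ez : expR (- z) <= z^-1.
  rewrite expRN lef_pV2 ?posrE ?expR_gt0//.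
  by apply: le_trans (expR_ge1Dx z); rewrite lerDr.
apply: (@le_trans _ _ ((Num.sqrt u)^-1 * z^-1)).
  by apply: ler_pM => //; rewrite ltW// gauss_peak_gt0.
have -> : (Num.sqrt u)^-1 * z^-1 = 16 * d%:R * Num.sqrt u / r ^+ 2.
  rewrite /z -[in X in _ * X^-1](sqr_sqrtr (ltW u0)).
  by field; rewrite !gt_eqF.
by rewrite ler_pM2r ?invr_gt0// ler_pM2l ?mulr_gt0// ler_wsqrtr.
Qed.

Lemma exit_bound_cvg0 d t e : (0 < d)%N -> 0 < e ->
  exists2 r0 : R, 0 < r0 & exit_bound d t r0 <= e.
Proof.
move=> d0 e0; have d0' : (0 : R) < d%:R by rewrite ltr0n.
pose A := 16 * d%:R * Num.sqrt t.
have A0 : 0 <= A by rewrite !mulr_ge0 ?sqrtr_ge0// ltW.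
(* With the base at most min (1, e), its d-th power is at most the base, hence at most e. *)
pose m := Num.min 1 e.
have m0 : 0 < m by rewrite lt_min ltr01.
have [m1 me] : m <= 1 /\ m <= e by rewrite /m !ge_min !lexx orbT.
pose r := Num.sqrt ((A + 1) / m).
have Am : 0 < (A + 1) / m by rewrite divr_gt0// ltr_wpDl.
have r0 : 0 < r by rewrite sqrtr_gt0.
exists r => //; rewrite /exit_bound -/A sqr_sqrtr ?(ltW Am)//.
have y0 : 0 <= A / ((A + 1) / m) by rewrite divr_ge0// ltW.
have ym : A / ((A + 1) / m) <= m.
  rewrite invf_div mulrA ler_pdivrMr ?ltr_wpDl//.
  by rewrite [leRHS]mulrC ler_pM2r// lerDl.
apply: (le_trans _ me); apply: (le_trans _ ym).
rewrite -[leRHS]expr1 ler_wiXn2l//.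
exact: (le_trans ym m1).
Qed.

End gaussian_interval.

(** * Independence of future increments from the past *)

Section independent_past.
Context dW (W : measurableType dW) (R : realType) (P : probability W R).
Context (J : finType) (Y : J -> W -> R).
Hypothesis mY : forall j, measurable_fun [set: W] (Y j).
Hypothesis iY : mutually_independent P Y.

Definition rectangle_event (S : pred J) (A : J -> set R) : set W :=
  \bigcap_(j in [set j | S j]) (Y j @^-1` A j).

Definition past_rectangles (S : pred J) : set (set W) :=
  [set E | exists2 A, (forall j, measurable (A j)) & E = rectangle_event S A].

Lemma rectangle_event_prob S A : (forall j, measurable (A j)) ->
  P (rectangle_event S A) = (\prod_(j | S j) P (Y j @^-1` A j))%E.
Proof.
move=> mA; rewrite /rectangle_event.
have -> : [set j | S j] = [set` enum S].
  by apply/seteqP; split => j /=; rewrite mem_enum.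
by rewrite iY ?enum_uniq// big_enum.
Qed.

Lemma measurable_preimageT (j : J) (A : set R) : measurable A -> measurable (Y j @^-1` A).
Proof. by move=> mA; rewrite -[X in measurable X]setTI; exact: mY. Qed.

Lemma measurable_rectangle_event S A : (forall j, measurable (A j)) ->
  measurable (rectangle_event S A).
Proof.
move=> mA; apply: fin_bigcap_measurable => [|j _]; first exact: finite_finset.
exact: measurable_preimageT.
Qed.

(** Both sides are finite measures in [E] that agree on the rectangles, a pi-system generating the
    past; uniqueness of measures extends the equality. *)
Lemma past_independent S (A : J -> set R) (E : set W) : (forall j, measurable (A j)) ->
  <<s past_rectangles S >> E ->
  P (E `&` rectangle_event (predC S) A) = (P E * P (rectangle_event (predC S) A))%E.
Proof.
move=> mA sE; set H := rectangle_event _ _.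
have mH : measurable H by exact: measurable_rectangle_event.
have PH : P H \is a fin_num by exact: fin_num_measure.
have PH0 : 0 <= fine (P H) by rewrite fine_ge0.
pose m2 := mscale (NngNum PH0) P.
have m2E F : m2 F = (P F * P H)%E by rewrite /m2 /mscale/= fineK// muleC.
rewrite -m2E.
rewrite -[LHS]/(mrestr P mH E).
have GT : past_rectangles S setT.
  exists (fun=> setT); first by move=> j; exact: measurableT.
  by apply/seteqP; split => // w _ j _.
apply: (@g_sigma_algebra_measure_unique _ R W (past_rectangles S) _ (fun=> setT)) sE => //.
- by move=> _ [B mB ->]; exact: measurable_rectangle_event.
- by apply/seteqP; split => // w _; exists 0%N.
- move=> _ _ [B mB ->] [C mC ->]; exists (fun j => B j `&` C j).
    by move=> j; exact: measurableI.
  by rewrite /rectangle_event -bigcapI.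
- move=> _ [B mB ->]; rewrite [RHS]m2E -[LHS]/(P (rectangle_event S B `&` H)).
  pose BA j := if S j then B j else A j.
  have mBA j : measurable (BA j) by rewrite /BA; case: ifP.
  have -> : rectangle_event S B `&` H = rectangle_event predT BA.
    apply/seteqP; split => w.
      by move=> [h1 h2] j _; rewrite /BA; case: ifPn => Sj; [exact: h1|exact: h2].
    move=> h; split=> j /= Sj; have := h j isT; rewrite /BA; first by rewrite Sj.
    by rewrite (negbTE Sj).
  rewrite !rectangle_event_prob// (bigID S)/=; congr (_ * _)%E.
    by apply: eq_bigr => j Sj; rewrite /BA Sj.
  by apply: eq_bigr => j Sj; rewrite /BA (negbTE Sj).
- move=> k; rewrite /mrestr (le_lt_trans (probability_le1 _ _)) ?ltry//.
  exact: measurableI.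
Qed.

End independent_past.

(** A bound conditional on each piece of a countable disjoint family passes to the union; the pieces
    are numbered by [pickle]. *)
Lemma countable_cond_bound dW (W : measurableType dW) (R : realType)
    (P : probability W R) (I : countType) (G : I -> set W) (C : set W) (c : R) :
  0 <= c -> (forall i, measurable (G i)) -> measurable C -> trivIset setT G ->
  (forall i, P (G i `&` C) <= c%:E * P (G i))%E ->
  (P ((\bigcup_i G i) `&` C) <= c%:E)%E.
Proof.
move=> c0 mG mC tG Gc.
pose F n := if @pickle_inv I n is Some i then G i else set0.
have mF n : measurable (F n) by rewrite /F; case: pickle_inv.
have FG : \bigcup_n F n = \bigcup_i G i.
  apply/seteqP; split => w [i _].
    by rewrite /F; case: pickle_inv => // j Gj; exists j.
  by move=> Gi; exists (pickle i) => //; rewrite /F pickleK_inv.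
have tF : trivIset setT F.
  move=> m n _ _ [w []]; rewrite /F.
  have := @pickle_invK I m; have := @pickle_invK I n.
  case: pickle_inv => [i|]//; case: pickle_inv => [j|]//= <- <- Gj Gi.
  by congr pickle; apply: (tG j i) => //; exists w.
rewrite -FG setI_bigcupl measure_bigcup//; last 2 first.
- by move=> n _; exact: measurableI.
- move=> m n _ _ [w [[Fm _] [Fn _]]]; apply: tF => //; by exists w.
apply: (@le_trans _ _ (\sum_(0 <= i <oo | i \in [set: nat]) c%:E * P (F i))%E).
  apply: lee_nneseries => [i _ _|i _]; first exact: measure_ge0.
  rewrite /F; case: pickle_inv => [j|]; first exact: Gc.
  by rewrite set0I measure0 mule_ge0// lee_fin.
rewrite nneseriesZl => [|i _]; last exact: measure_ge0.
rewrite -measure_bigcup//; rewrite -[leRHS]mule1 lee_wpmul2l ?lee_fin//.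
by apply: probability_le1; exact: bigcupT_measurable.
Qed.

(** * First exit on a discrete grid of times *)

Section exit_events.
Context {R : realType} {d : nat} {W : Type}.
Variables (V : nat -> 'I_d -> W -> R) (lo hi : 'I_d -> R) (delta : R).

Definition inside_event i : set W := [set w | forall l, lo l <= V i l w <= hi l].

Definition first_exit j : set W :=
  [set w | (forall i, (i < j)%N -> inside_event i w) /\ ~ inside_event j w].

(** Half-open cells partition the possible positions, so that conditioning on the exit position
    becomes a countable sum. *)
Definition cell j (m : 'rV[int]_d) : set W :=
  [set w | forall l, (m 0 l)%:~R * delta <= V j l w < (m 0 l + 1)%:~R * delta].

Lemma first_exit_disjoint i j w : first_exit i w -> first_exit j w -> i = j.
Proof.
move=> [h1 h2] [h3 h4]; apply/eqP; rewrite eqn_leq; apply/andP; split; rewrite leqNgt.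
  by apply/negP => /h1.
by apply/negP => /h3.
Qed.

Lemma cell_disjoint j m m' w : 0 < delta -> cell j m w -> cell j m' w -> m = m'.
Proof.
move=> d0 h h'; apply/rowP => l; have := h l; have := h' l.
rewrite -!ler_pdivlMr// -!ltr_pdivrMr//.
by move=> /floor_def <- /floor_def <-.
Qed.

Lemma cell_cover j w : 0 < delta -> exists m, cell j m w.
Proof.
move=> d0; exists (\row_l Num.floor (V j l w / delta)) => l; rewrite mxE.
by rewrite -ler_pdivlMr// -ltr_pdivrMr//; exact: floor_itv.
Qed.

End exit_events.

Lemma measurable_inside_event dW (W : measurableType dW) (R : realType) d
    (V : nat -> 'I_d -> W -> R) (lo hi : 'I_d -> R) i :
  (forall l, measurable_fun [set: W] (V i l)) ->
  measurable (inside_event V lo hi i).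
Proof.
move=> mV; rewrite (_ : inside_event _ _ _ _ =
    \bigcap_(l in [set: 'I_d]) (V i l @^-1` [set` `[lo l, hi l]])).
  apply: fin_bigcap_measurable => // l _.
  by rewrite -[X in measurable X]setTI; exact: mV.
apply/seteqP; split => w h l; first by move=> _; rewrite /= in_itv; exact: h.
by have := h l I; rewrite /= in_itv.
Qed.

(** Measurability is asked only up to time [j] and over an arbitrary measurable space, so that the
    lemma also applies to the sigma-algebra of the past. *)
Lemma measurable_first_exit_cell dW (W : measurableType dW) (R : realType) d
    (V : nat -> 'I_d -> W -> R) (lo hi : 'I_d -> R) (delta : R) j m :
  (forall i l, (i <= j)%N -> measurable_fun [set: W] (V i l)) ->
  measurable (first_exit V lo hi j `&` cell V delta j m).
Proof.
move=> mV.
have mpre i l (A : set R) : (i <= j)%N -> measurable A -> measurable (V i l @^-1` A).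
  by move=> ij mA; rewrite -[X in measurable X]setTI; exact: mV.
have mI i : (i <= j)%N -> measurable (inside_event V lo hi i).
  by move=> ij; apply: measurable_inside_event => l; exact: mV.
apply: measurableI.
  rewrite (_ : first_exit _ _ _ _ = (\bigcap_(i in [set` 'I_j]) inside_event V lo hi i)
     `&` ~` inside_event V lo hi j).
    apply: measurableI; last by apply: measurableC; exact: mI.
    by apply: fin_bigcap_measurable => // i _; apply: mI; exact: ltnW.
  apply/seteqP; split => w [h1 h2]; split => // i; first by move=> _; exact: h1.
  by move=> ij; exact: (h1 (Ordinal ij)).
rewrite (_ : cell _ _ _ _ = \bigcap_(l in [set: 'I_d])
    (V j l @^-1` [set` `[(m 0 l)%:~R * delta, (m 0 l + 1)%:~R * delta[])).
  by apply: fin_bigcap_measurable => // l _; apply: mpre.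
apply/seteqP; split => w h l; first by move=> _; rewrite /= in_itv; exact: h.
by have := h l I; rewrite /= in_itv.
Qed.

(** * Exit and return of Brownian motion *)

Section brownian_exit.
Context (R : realType) (d : nat) dW (W : measurableType dW).
Variables (P : probability W R) (B : R -> W -> 'rV[R]_d).
Hypothesis hB : brownian_motion P B.
Hypothesis hd : (0 < d)%N.
Variables (t r delta : R) (lo hi : 'I_d -> R).
Hypotheses (t0 : 0 < t) (delta0 : 0 < delta) (delta_r : 4 * delta <= r).
Hypothesis exit_far : forall l b, ~~ (lo l <= b <= hi l) -> r < `|b|.

Definition grid (n i : nat) : R := i%:R * t / 2 ^+ n.
Definition grid_coord (n i : nat) (l : 'I_d) (w : W) : R := B (grid n i) w 0 l.
Definition end_event : set W := [set w | forall l, 0 <= B t w 0 l <= delta].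
Definition grid_exit (n : nat) : set W :=
  [set w | exists2 i, (i <= 2 ^ n)%N & ~ inside_event (grid_coord n) lo hi i w].

Let r0 : 0 < r. Proof. by apply: lt_le_trans delta_r; rewrite mulr_gt0. Qed.

Let pow0 n : (0 : R) < 2 ^+ n. Proof. by rewrite exprn_gt0. Qed.

Let grid_ge0 n i : 0 <= grid n i.
Proof. by rewrite /grid divr_ge0 ?mulr_ge0// ltW. Qed.

Let grid_le n i j : (i <= j)%N -> grid n i <= grid n j.
Proof. by move=> ij; rewrite /grid ler_pM2r ?invr_gt0// ler_pM2r// ler_nat. Qed.

Let gridT n : grid n (2 ^ n) = t.
Proof. by rewrite /grid natrX mulrAC mulfV ?mul1r// gt_eqF. Qed.

Let grid_lt n j : (j < 2 ^ n)%N -> grid n j < t.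
Proof.
by move=> jn; rewrite -[ltRHS](gridT n) /grid ltr_pM2r ?invr_gt0// ltr_pM2r// ltr_nat.
Qed.

Let mB s l : 0 <= s -> measurable_fun [set: W] (fun w => B s w 0 l).
Proof. by case: hB => _ _ h _ _; exact: h. Qed.

Let mV n i l : measurable_fun [set: W] (grid_coord n i l).
Proof. exact: mB. Qed.

Lemma measurable_end_event : measurable end_event.
Proof.
have := @measurable_inside_event _ W R d (fun _ l w => B t w 0 l) (fun=> 0) (fun=> delta) 0%N.
by apply => l; apply: mB; exact: ltW.
Qed.

Lemma measurable_grid_exit n : measurable (grid_exit n).
Proof.
rewrite (_ : grid_exit n = \bigcup_(i in [set i | (i <= 2 ^ n)%N])
   ~` inside_event (grid_coord n) lo hi i); last first.
  by apply/seteqP; split => w [i]; exists i.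
apply: bigcup_measurable => i _; apply: measurableC.
by apply: measurable_inside_event => l; exact: mV.
Qed.

(* Given that the position at the exit time lies in a prescribed cell, the end
   event forces the remaining increment, which is independent of the past, into
   a cube of side [2 * delta] at distance at least [r / 2] from the origin. *)
Lemma first_exit_cell_le n j m : (j < 2 ^ n)%N ->
  (P (first_exit (grid_coord n) lo hi j `&` cell (grid_coord n) delta j m `&` end_event)
   <= (exit_bound d t r * (2 * delta) ^+ d)%:E
      * P (first_exit (grid_coord n) lo hi j `&` cell (grid_coord n) delta j m))%E.
Proof.
move=> jn; set G := _ `&` cell _ _ _ _.
have mG : measurable G.
  by apply: measurable_first_exit_cell => i l _; exact: mV.
have c0 : 0 <= exit_bound d t r * (2 * delta) ^+ d.
  by rewrite mulr_ge0 ?exit_bound_ge0// exprn_ge0// mulr_ge0// ltW.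
have [->|/set0P[w0 [[_ exit0] cell0]]] := eqVneq G set0.
  by rewrite set0I measure0 mule_ge0// lee_fin.
(* One outcome [w0] in the event locates the whole cell: in coordinate [l0] it contains a point at
   distance more than r from 0. *)
have [l0 hl0] : exists l0, r < `|grid_coord n j l0 w0|.
  move/existsNP : exit0 => [l0 /negP h]; exists l0; exact: exit_far h.
case: hB => B0 _ _ Bnorm Bind.
(* Grid times up to the exit, then directly [t]: the increment of index [j] is the whole remaining
   displacement. *)
pose tau i := if (i <= j)%N then grid n i else t.
have tau0 : 0 <= tau 0%N by rewrite /tau leq0n; exact: grid_ge0.
have tauS i : tau i <= tau i.+1.
  rewrite /tau; have [ij|ij] := leqP i.+1 j; first by rewrite (ltnW ij) grid_le.
  by case: ifP => // ij'; apply/ltW/grid_lt; exact: leq_ltn_trans jn.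
pose Y (p : 'I_j.+1 * 'I_d) (w : W) := B (tau p.1.+1) w 0 p.2 - B (tau p.1) w 0 p.2.
have iY : mutually_independent P Y by exact: Bind.
have tau_ge0 i : 0 <= tau i by rewrite /tau; case: ifP => // _; exact: ltW.
have mY p : measurable_fun [set: W] (Y p) by apply: measurable_funB; exact: mB.
pose S : pred ('I_j.+1 * 'I_d) := fun p => (p.1 < j)%N.
(* The displacements from the cell to [0, delta], coordinate by coordinate: intervals of length 2
   delta. *)
pose A (p : 'I_j.+1 * 'I_d) : set R :=
  [set` `[- ((m 0 p.2 + 1)%:~R * delta), delta - (m 0 p.2)%:~R * delta]].
have mA p : measurable (A p) by exact: measurable_itv.
pose H := rectangle_event Y (predC S) A.
have mH : measurable H by exact: measurable_rectangle_event.
have pastG : <<s past_rectangles Y S >> G.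
  apply: (@measurable_first_exit_cell _ (g_sigma_algebraType (past_rectangles Y S))).
  move=> i l ij.
  (* The path starts at 0, so its position at a grid time is a sum of past increments. *)
  rewrite (_ : grid_coord n i l = fun w => \sum_(k < i) Y (inord k, l) w).
    apply: measurable_sum => k _ C mC; rewrite setTI; apply: sub_gen_smallest.
    exists (fun p => if p == (inord k, l) then C else setT).
      by move=> p; case: ifP.
    apply/seteqP; split => w /=.
      by move=> Cw p _ /=; case: eqP => // ->.
    have kj : S (inord k, l).
      by rewrite /S/= inordK; [exact: leq_trans ij|exact: leq_trans (ltnW _)].
    by move=> /(_ _ kj) /=; rewrite eqxx.
  apply/funext => w.
  rewrite (eq_bigr (fun k : 'I_i => B (grid n k.+1) w 0 l - B (grid n k) w 0 l)).
    rewrite -(big_mkord predT (fun k => B (grid n k.+1) w 0 l - B (grid n k) w 0 l)).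
    rewrite (telescope_sumr (fun k => B (grid n k) w 0 l))//.
    by rewrite [grid n 0]/grid mul0r mul0r B0 mxE subr0.
  move=> k _; have ki := ltn_ord k; have kj : (k < j)%N by exact: leq_trans ij.
  have ik : (inord k : 'I_j.+1) = k :> nat by apply: inordK; rewrite ltnS (ltnW kj).
  by rewrite /Y [(_, _).1]/= [(_, _).2]/= ik /tau kj (ltnW kj).
have PGH := past_independent mY iY mA pastG.
have sub : G `&` end_event `<=` G `&` H.
  move=> w [Gw endw]; split => // p /= nS.
  have pj : p.1 = j :> nat.
    by apply/eqP; rewrite eqn_leq -ltnS ltn_ord/= leqNgt.
  have [_ /(_ p.2)] := Gw; have := endw p.2.
  rewrite /A /Y /= in_itv/= pj /tau ltnn leqnn /grid_coord intrD.
  by move: (B _ w 0 _) (B t w 0 _) ((m 0 p.2)%:~R * delta) => b b' md; lra.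
have u0 : 0 < t - grid n j by rewrite subr_gt0 grid_lt.
have PH : (P H <= (exit_bound d t r * (2 * delta) ^+ d)%:E)%E.
  rewrite /H rectangle_event_prob//.
  have -> : (\prod_(p | predC S p) P (Y p @^-1` A p) =
      \prod_(l < d) P (Y (ord_max, l) @^-1` A (ord_max, l)))%E.
    rewrite (eq_bigl (fun p : 'I_j.+1 * 'I_d => (p.1 == ord_max) && true)); last first.
      move=> [k l] /=; rewrite /S/= -leqNgt andbT -val_eqE/= eqn_leq.
      by have := ltn_ord k; rewrite ltnS => ->.
    rewrite -(pair_big (pred1 ord_max) predT
      (fun k l => P (Y (k, l) @^-1` A (k, l))))/=.
    by rewrite big_pred1_eq.
  set u := t - grid n j in u0.
  (* Only coordinate [l0] supplies decay: there the displacement is at least r - 2 delta >= r / 2.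
     The other coordinates are bounded by the Gaussian peak. *)
  pose rho l := if l == l0 then r / 2 else 0.
  pose g l := gauss_peak u * expR (- (rho l ^+ 2 / (4 * u))) * (2 * delta).
  have Pl l : (0 <= P (Y (ord_max, l) @^-1` A (ord_max, l)) <= (g l)%:E)%E.
    rewrite measure_ge0/=.
    have -> : P (Y (ord_max, l) @^-1` A (ord_max, l)) =
        normal_prob 0 (Num.sqrt (2 * u)) (A (ord_max, l)).
      rewrite /u -(Bnorm (grid n j) t l)//; last by rewrite -subr_gt0.
      congr (P _); apply/seteqP; split => w;
        by rewrite /Y /= /tau ltnn leqnn.
    have cl := cell0 l.
    have -> : g l = gauss_peak u * expR (- (rho l ^+ 2 / (4 * u))) *
        ((delta - (m 0 l)%:~R * delta) - (- ((m 0 l + 1)%:~R * delta))).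
      rewrite /g; congr (_ * _).
      by rewrite intrD; ring.
    apply: normal_prob_itv_le => //.
    - by rewrite intrD; lra.
    - by rewrite /rho; case: ifP => // _; rewrite divr_ge0// ltW.
    move=> y yI; rewrite /rho; case: eqP => [ll|_]; last exact: normr_ge0.
    move: hl0 cl yI delta_r; rewrite ll intrD mulrDl mul1r.
    move: (grid_coord n j l0 w0) ((m 0 l0)%:~R * delta) => v md.
    move=> + /andP[h2 h3] /andP[h4 h5] h6.
    have [v0|v0] := leP 0 v.
      by rewrite (ger0_norm v0) => h1; rewrite ler0_norm; lra.
    by rewrite (ltr0_norm v0) => h1; rewrite ger0_norm; lra.
  apply: (@le_trans _ _ (\prod_(l < d) (g l)%:E)%E).
    by apply: lee_prod => l _; exact: Pl.
  rewrite prodEFin lee_fin /g !big_split/= !prodr_const card_ord exprMn ler_pM2r; last first.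
    by rewrite mulr_gt0 ?exprn_gt0.
  rewrite (bigD1 l0)//= big1 => [|l /negbTE ll0]; last first.
    by rewrite /rho ll0 expr0n/= mul0r oppr0 expR0.
  rewrite mulr1 /rho eqxx; apply: exit_bound_ge => //.
  by rewrite /u gerBl.
apply: (@le_trans _ _ (P (G `&` H))).
  apply: le_measure; rewrite ?inE//; apply: measurableI => //.
  exact: measurable_end_event.
by rewrite PGH muleC lee_wpmul2r// measure_ge0.
Qed.

Lemma exit_before_le : (forall l b, 0 <= b <= delta -> lo l <= b <= hi l) ->
  (P ((\bigcup_n grid_exit n) `&` end_event)
   <= (exit_bound d t r * (2 * delta) ^+ d)%:E)%E.
Proof.
move=> inT; have mE := measurable_end_event.
have stepn n : (P (grid_exit n `&` end_event)
   <= (exit_bound d t r * (2 * delta) ^+ d)%:E)%E.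
  pose G (p : 'I_(2 ^ n) * 'rV[int]_d) := first_exit (grid_coord n) lo hi p.1
    `&` cell (grid_coord n) delta p.1 p.2.
  have mG p : measurable (G p).
    by apply: measurable_first_exit_cell => i l _; exact: mV.
  apply: (@le_trans _ _ (P ((\bigcup_p G p) `&` end_event))).
    apply: le_measure; rewrite ?inE.
    - by apply: measurableI => //; exact: measurable_grid_exit.
    - apply: measurableI => //.
      exact: countable_bigcupT_measurable (countableP _) mG.
    move=> w [[i i2 exiti] endw]; split => //.
    have ex : exists i, (i <= 2 ^ n)%N && `[< ~ inside_event (grid_coord n) lo hi i w >].
      by exists i; rewrite i2; exact/asboolP.
    case: (ex_minnP ex) => k /andP[k2 /asboolP exitk] kmin.
    (* The final time cannot be the first exit, because the end cube lies inside. *)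
    have {}k2 : (k < 2 ^ n)%N.
      rewrite ltn_neqAle k2 andbT; apply/eqP => kT; apply: exitk.
      by move=> l; rewrite /grid_coord kT gridT; apply: inT; exact: endw.
    have [m cm] := cell_cover (grid_coord n) k w delta0.
    exists (Ordinal k2, m) => //; split => //; split => // i' /= ik.
    apply: contrapT => ni; move: (ik); rewrite ltnNge => /negP; apply.
    by apply: kmin; rewrite (leq_trans (ltnW ik) (ltnW k2)); exact/asboolP.
  apply: countable_cond_bound => //.
  - by rewrite mulr_ge0 ?exit_bound_ge0// exprn_ge0// mulr_ge0// ltW.
  - move=> [i m] [j m'] _ _ [w [[/= Fi ci] [/= Fj cj]]].
    have ij : i = j by apply: val_inj; exact: first_exit_disjoint Fi Fj.
    by rewrite ij in ci *; rewrite (cell_disjoint delta0 ci cj).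
  - by move=> [i m]; exact: first_exit_cell_le.
pose F n := grid_exit n `&` end_event.
have mF n : measurable (F n) by apply: measurableI => //; exact: measurable_grid_exit.
have cvgP : (P \o F) n @[n --> \oo] --> P (\bigcup_n F n).
  apply: nondecreasing_cvg_mu => //; first exact: bigcupT_measurable.
  apply/nondecreasing_seqP => n; apply/subsetPset => w [[i i2 exiti] endw]; split => //.
  (* Dyadic grids are nested, so the exit events increase with [n] and the uniform bound passes to
     the union. *)
  exists (2 * i)%N; first by rewrite expnS leq_mul2l.
  rewrite /inside_event/= /grid_coord.
  suff -> : grid n.+1 (2 * i) = grid n i by [].
  by rewrite /grid natrM exprS; field; rewrite gt_eqF.
rewrite setI_bigcupl -(cvg_lim _ cvgP)//; apply: lime_le.
  by apply/cvg_ex; eexists; exact: cvgP.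
by apply: nearW => n; exact: stepn.
Qed.

(** The complement of the closed box is open and paths are continuous, so an exit at time s is
    already seen at a nearby dyadic time; [i] below gives the last grid time not after s. *)
Lemma exit_grid_exit w : (exists2 s, 0 <= s <= t & ~ forall l, lo l <= B s w 0 l <= hi l) <->
  (\bigcup_n grid_exit n) w.
Proof.
case: hB => _ Bcont _ _ _; split; last first.
  move=> [n _ [i i2 exiti]]; exists (grid n i) => //.
  by rewrite grid_ge0 -[X in _ <= X](gridT n) grid_le.
move=> [s /andP[s0 st] /existsNP[l /negP exits]].
have : (fun u => B u w 0 l) u @[u --> within `[0, +oo[ (nbhs s)] --> B s w 0 l.
  have /subspace_continuousP /(_ s) := Bcont w.
  rewrite /= in_itv/= s0 => /(_ isT) h.
  exact: (cvg_comp _ _ h (@coord_continuous _ _ _ _ _ _)).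
pose e := Num.max (lo l - B s w 0 l) (B s w 0 l - hi l).
have e0 : 0 < e.
  by rewrite /e lt_max !subr_gt0; move: exits; rewrite negb_and -!ltNge.
move=> /cvgrPdist_lt /(_ e e0) /nbhs_ballP[eta /= eta0 near_s].
have [n tn] : exists n, t / 2 ^+ n < eta.
  exists (Num.truncn (t / eta)).
  rewrite ltr_pdivrMr// mulrC -ltr_pdivrMr//.
  have te0 : 0 <= t / eta by rewrite divr_ge0// ltW.
  have /andP[_ h] := truncn_itv te0; apply: (lt_le_trans h).
  by rewrite -natrX ler_nat ltn_expl.
pose i := Num.truncn (s * 2 ^+ n / t).
have y0 : 0 <= s * 2 ^+ n / t by rewrite divr_ge0 ?mulr_ge0// ltW.
have /andP[i1 i2] := truncn_itv y0; rewrite -/i in i1 i2.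
have gi : grid n i <= s.
  by rewrite /grid ler_pdivrMr// -ler_pdivlMr.
have gi' : s < grid n i + t / 2 ^+ n.
  rewrite /grid -mulrDl -[X in _ * t + X]mul1r -mulrDl natr1.
  by rewrite ltr_pdivlMr// -ltr_pdivrMr.
exists n => //; exists i.
  rewrite -(ler_nat R) natrX; apply: (le_trans i1).
  by rewrite ler_pdivrMr// mulrC ler_pM2l.
move=> /(_ l); rewrite /grid_coord => /andP[h1 h2].
have : `|B s w 0 l - B (grid n i) w 0 l| < e.
  apply: near_s; last by rewrite in_itv/= grid_ge0.
  rewrite /ball/= ger0_norm ?subr_ge0//; lra.
have n1 := ler_norm (B s w 0 l - B (grid n i) w 0 l).
have n2 := ler_norm (B (grid n i) w 0 l - B s w 0 l).
rewrite distrC in n2.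
by rewrite /e lt_max => /orP[] h; lra.
Qed.

End brownian_exit.

Lemma borel_cube (R : realType) d (lo hi : 'I_d -> R) : borel (cube lo hi).
Proof.
have -> : cube lo hi = \bigcap_(l in [set: 'I_d])
    ((fun y : 'rV[R]_d => y 0 l) @^-1` [set` `[lo l, hi l]]).
  apply/seteqP; split => y h l; first by move=> _; rewrite /= in_itv; exact: h.
  by have := h l I; rewrite /= in_itv.
rewrite -[X in borel X]setCK -setTD; apply: sigma_algebraCD.
apply: sub_gen_smallest; apply: closed_openC.
apply: closed_bigI => l _; apply: closed_comp; last exact: interval_closed.
by move=> y _; exact: coord_continuous.
Qed.

Section brownian_cube.
Context (R : realType) (d : nat) dW (W : measurableType dW).
Variables (P : probability W R) (B : R -> W -> 'rV[R]_d).
Hypothesis hB : brownian_motion P B.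

(** Independence of the coordinates is that of the increments over the single step from 0 to t. *)
Lemma brownian_cube_prob (t : R) (a b : 'I_d -> R) : 0 < t ->
  P [set w | forall l, a l <= B t w 0 l <= b l]
  = (\prod_(l < d) normal_prob 0 (Num.sqrt (2 * t)) [set` `[a l, b l]])%E.
Proof.
move=> t0; case: hB => B0 _ mB Bnorm Bind.
pose tau i := if i is 0%N then 0 else t.
have tauS i : tau i <= tau i.+1 by case: i => //=; exact: ltW.
pose Y (p : 'I_1 * 'I_d) w := B (tau p.1.+1) w 0 p.2 - B (tau p.1) w 0 p.2.
have iY : mutually_independent P Y by apply: Bind.
pose A (p : 'I_1 * 'I_d) : set R := [set` `[a p.2, b p.2]].
have mA p : measurable (A p) by exact: measurable_itv.
have -> : [set w | forall l, a l <= B t w 0 l <= b l] = rectangle_event Y predT A.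
  apply/seteqP; split => w h.
    move=> [k l] _; rewrite /Y /A /= (ord1 k)/= B0 mxE subr0 in_itv/=.
    exact: h.
  by move=> l; have := h (ord0, l) isT; rewrite /Y /A /= B0 mxE subr0 in_itv.
rewrite rectangle_event_prob//.
rewrite -(pair_big predT predT (fun k l => P (Y (k, l) @^-1` A (k, l))))/=.
rewrite big_ord1; apply: eq_bigr => l _.
have := Bnorm 0 t l (A (ord0, l)) (lexx 0) t0 (mA _); rewrite subr0 => <-.
by congr (P _); apply/seteqP; split => w.
Qed.

Lemma brownian_cube_le (t delta : R) (a : 'I_d -> R) : 0 < t -> 0 < delta ->
  (P [set w | forall l, (a l <= B t w 0 l <= a l + delta)%R]
   <= (heat_peak d t * delta ^+ d)%:E)%E.
Proof.
move=> t0 d0; rewrite brownian_cube_prob//.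
rewrite -gauss_peakX// -exprMn -[in X in (_ <= (_ ^+ X)%:E)%E](card_ord d).
rewrite -prodr_const -prodEFin.
apply: lee_prod => l _; apply/andP; split.
  by apply: integral_ge0 => x _; rewrite lee_fin normal_pdf_ge0.
have := @normal_prob_itv_le R t (a l) (a l + delta) 0 t0.
rewrite expr0n/= mul0r oppr0 expR0 mulr1 [_ + _ - _]addrC addKr; apply => //.
by rewrite lerDl ltW.
Qed.

Lemma brownian_cube_ge (t delta : R) : 0 < t -> 0 < delta ->
  ((heat_peak d t * expR (- (delta ^+ 2 / (4 * t))) ^+ d * delta ^+ d)%:E
   <= P (end_event B t delta))%E.
Proof.
move=> t0 d0; rewrite /end_event brownian_cube_prob//.
rewrite -gauss_peakX// -!exprMn -[in X in (_ ^+ X)%:E](card_ord d) -prodr_const -prodEFin.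
apply: lee_prod => l _; apply/andP; split.
  by rewrite lee_fin !mulr_ge0 ?expR_ge0// ltW// gauss_peak_gt0.
have := @normal_prob_itv_ge R t 0 delta delta t0 (ltW d0).
by rewrite subr0; apply => x /andP[x0 xd]; rewrite ger0_norm.
Qed.

End brownian_cube.

(** * Diagonal bounds for the killed transition density *)

Section killed_density.
Context (R : realType) (d N : nat).
Variable p : R -> 'rV[R]_d -> 'rV[R]_d -> R.
Hypothesis hp : killed_transition_density (box N) p.
Hypothesis hd : (0 < d)%N.

Lemma killed_density_continuous (t e : R) x : 0 < t -> box N x -> 0 < e ->
  exists2 eta : R, 0 < eta & forall y, box N y ->
    (forall l, `|x 0 l - y 0 l| < eta) -> `|p t x x - p t x y| < e.
Proof.
move=> t0 Dx e0; case: hp => _ /(_ t t0) /subspace_continuousP /(_ (x, x)) h _.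
have := h (conj Dx Dx) => /cvgrPdist_lt /(_ e e0) /nbhs_ballP[eta /= eta0 near_x].
exists eta => // y Dy xy; apply: (near_x (x, y)) => //=.
split => /=; first exact: ballxx.
by split => // i j; rewrite (ord1 i); exact: xy.
Qed.

(** Survival at all real times is expressed through dyadic exits, which makes the event
    measurable. *)
Lemma killed_event (x : 'rV[R]_d) (t : R) dW (W : measurableType dW)
    (P : probability W R) (B : R -> W -> 'rV[R]_d) (A : set 'rV[R]_d) :
  0 < t -> brownian_motion P B ->
  [set w | A (x + B t w) /\ forall s, 0 <= s <= t -> box N (x + B s w)]
  = [set w | A (x + B t w)] `\` \bigcup_n grid_exit B t
      (fun l => - N%:R - x 0 l) (fun l => N%:R - x 0 l) n.
Proof.
move=> t0 hB.
have boxE s w : box N (x + B s w) <->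
    forall l, - N%:R - x 0 l <= B s w 0 l <= N%:R - x 0 l.
  by split => h l; have := h l; rewrite ?mxE lerBlDl lerBrDl.
apply/seteqP; split => w [Aw h]; split => //.
  move=> /(exit_grid_exit hB _ _ t0)[s st]; apply; apply/boxE; exact: h.
move=> s st; apply: contrapT => ns; apply: h; apply/(exit_grid_exit hB _ _ t0).
by exists s => // /boxE.
Qed.

(** Otherwise, by continuity, the killed motion would hit a small cube at x with larger probability
    than the free motion does. *)
Lemma killed_diag_le (t : R) x : (0 < N)%N -> 0 < t -> box N x ->
  p t x x <= heat_peak d t.
Proof.
move=> N0 t0 Dx; rewrite leNgt; apply/negP => ltp.
pose e := (p t x x - heat_peak d t) / 2.
have e0 : 0 < e by rewrite divr_gt0// subr_gt0.
have [eta eta0 hc] := killed_density_continuous t0 Dx e0.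
pose delta := Num.min (eta / 2) N%:R.
have d0 : 0 < delta by rewrite lt_min divr_gt0// ltr0n.
have [de dN] : delta <= eta / 2 /\ delta <= N%:R by rewrite /delta !ge_min !lexx orbT.
(* The cube extends from x towards the centre in each coordinate, so it stays in the box even if x
   is on the boundary. *)
pose lo l := if x 0 l <= 0 then x 0 l else x 0 l - delta.
pose C := cube lo (fun l => lo l + delta).
have CD : C `<=` box N.
  move=> y yC l; have /andP := yC l; have /andP := Dx l.
  rewrite /= /lo => -[h1 h2].
  by have [xl|xl] := leP (x 0 l) 0 => -[h3 h4]; apply/andP; split; lra.
have Cx y : C y -> `|p t x x - p t x y| < e.
  move=> yC; apply: hc; first exact: CD.
  move=> l; have /andP := yC l; rewrite /= /lo ltr_norml.
  by have [xl|xl] := leP (x 0 l) 0 => -[h1 h2]; apply/andP; split; lra.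
case: (hp) => _ _ [dW [W [P [B [hB hK]]]]].
have hPK := hK t x C t0 Dx (borel_cube _ _) CD.
have c0 : 0 <= p t x x - e.
  by have := heat_peak_gt0 d t0; rewrite /e; lra.
have lower : (((p t x x - e) * delta ^+ d)%:E <=
    integral_rV_on C (fun y => (p t x y)%:E))%E.
  have -> : delta ^+ d = \prod_(l < d) (lo l + delta - lo l).
    rewrite (eq_bigr (fun=> delta)) => [|l _]; first by rewrite prodr_const card_ord.
    by rewrite addrC addKr.
  rewrite -integral_rV_on_cube//; last by move=> l; rewrite lerDl ltW.
  apply: ge0_le_integral_rV_on => // y yC; rewrite lee_fin.
    by have := Cx y yC; rewrite ltr_distl => /andP[h1 h2]; lra.
  by have := Cx y yC; rewrite ltr_distl => /andP[h1 h2]; lra.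
have mend : measurable [set w | forall l, lo l - x 0 l <= B t w 0 l <= lo l - x 0 l + delta].
  case: (hB) => _ _ mB _ _.
  apply: (@measurable_inside_event _ W R d (fun _ l w => B t w 0 l) _ _ 0%N) => l.
  by apply: mB; exact: ltW.
have CE : [set w | C (x + B t w)] =
    [set w | forall l, lo l - x 0 l <= B t w 0 l <= lo l - x 0 l + delta].
  by apply/seteqP; split => w h l; have /andP := h l; rewrite /= !mxE => -[h1 h2];
    apply/andP; split; lra.
have upper : (integral_rV_on C (fun y => (p t x y)%:E) <= (heat_peak d t * delta ^+ d)%:E)%E.
  rewrite -hPK; apply: le_trans (brownian_cube_le hB (fun l => lo l - x 0 l) t0 d0).
  apply: le_measure; rewrite ?inE//.
    rewrite (killed_event _ _ t0 hB) CE; apply: measurableD => //.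
    by apply: bigcupT_measurable => n; exact: (measurable_grid_exit hB).
  by rewrite -CE => w [].
have := le_trans lower upper; rewrite lee_fin ler_pM2r ?exprn_gt0// /e; lra.
Qed.

(** The free probability of the small cube at x is at most the killed one plus that of exit and
    return; divide by the volume of the cube. *)
Lemma killed_diag_ge (t r : R) (x : 'rV[R]_d) : 0 < t -> 0 < r ->
  (forall l, `|x 0 l| <= N%:R - r) ->
  heat_peak d t - exit_bound d t r * 2 ^+ d <= p t x x.
Proof.
move=> t0 r0 xr; rewrite leNgt; apply/negP => ltp.
have Dx : box N x.
  by move=> l; have := xr l; rewrite ler_norml => /andP[h1 h2]; apply/andP; split; lra.
set k := exit_bound d t r * 2 ^+ d in ltp.
(* One third of the gap goes to continuity of the density, one to the variation of the Gaussian on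
   the cube; the last gives the contradiction. *)
pose e := (heat_peak d t - k - p t x x) / 3.
have e0 : 0 < e by rewrite divr_gt0// subr_gt0.
have [eta eta0 hc] := killed_density_continuous t0 Dx e0.
have p0 := heat_peak_gt0 d t0.
have d0' : (0 : R) < d%:R by rewrite ltr0n.
(* As delta <= 1 and delta <= z, delta^2 <= z, which bounds the loss peak d delta^2 / (4 t) by e. *)
pose z := e * (4 * t) / (d%:R * heat_peak d t).
have z0 : 0 < z by apply: divr_gt0; apply: mulr_gt0 => //; exact: mulr_gt0.
pose delta := Num.min (Num.min (eta / 2) (r / 4)) (Num.min 1 z).
have d0 : 0 < delta by rewrite !lt_min z0 ltr01 !divr_gt0//.
have [de dr d1 dz] : [/\ delta <= eta / 2, delta <= r / 4, delta <= 1 & delta <= z].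
  by rewrite /delta !ge_min !lexx !orbT.
pose lo l := x 0 l.
pose C := cube lo (fun l => lo l + delta).
have CD : C `<=` box N.
  move=> y yC l; have /andP := yC l; have := xr l; rewrite ler_norml => /andP.
  by rewrite /= /lo => -[h1 h2] [h3 h4]; apply/andP; split; lra.
have Cx y : C y -> `|p t x x - p t x y| < e.
  move=> yC; apply: hc; first exact: CD.
  move=> l; have /andP := yC l; rewrite /= /lo ltr_norml.
  by move=> [h1 h2]; apply/andP; split; lra.
case: (hp) => pos _ [dW [W [P [B [hB hK]]]]].
have hPK := hK t x C t0 Dx (borel_cube _ _) CD.
have pxx : 0 <= p t x x by exact: pos.
have upper : (integral_rV_on C (fun y => (p t x y)%:E) <= ((p t x x + e) * delta ^+ d)%:E)%E.
  have -> : delta ^+ d = \prod_(l < d) (lo l + delta - lo l).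
    rewrite (eq_bigr (fun=> delta)) => [|l _]; first by rewrite prodr_const card_ord.
    by rewrite addrC addKr.
  rewrite -integral_rV_on_cube//; last by rewrite addr_ge0// ltW.
    apply: ge0_le_integral_rV_on => // y yC; rewrite lee_fin.
    - by apply: pos => //; exact: CD.
    - by have := Cx y yC; rewrite ltr_distl => /andP[h1 h2]; lra.
    - by rewrite addr_ge0// ltW.
  by move=> l; rewrite lerDl ltW.
pose xlo l := - N%:R - x 0 l.
pose xhi l := N%:R - x 0 l.
have CE : [set w | C (x + B t w)] = end_event B t delta.
  by apply/seteqP; split => w h l; have /andP := h l; rewrite /= !mxE /lo => -[h1 h2];
    apply/andP; split; lra.
have mend : measurable (end_event B t delta) by exact: (measurable_end_event hB).
have mexit : measurable (\bigcup_n grid_exit B t xlo xhi n).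
  by apply: bigcupT_measurable => n; exact: (measurable_grid_exit hB).
have dr4 : 4 * delta <= r by lra.
have far l b : ~~ (xlo l <= b <= xhi l) -> r < `|b|.
  rewrite negb_and -!ltNge /xlo /xhi ltr_normr; have := xr l; rewrite ler_norml.
  by move=> /andP[h1 h2] /orP[] h3; apply/orP; [right|left]; lra.
have inT l b : 0 <= b <= delta -> xlo l <= b <= xhi l.
  rewrite /xlo /xhi; have := xr l; rewrite ler_norml => /andP[h1 h2] /andP[h3 h4].
  by apply/andP; split; lra.
have exitle := exit_before_le hB hd t0 d0 dr4 far inT.
have : (P (end_event B t delta) <=
    integral_rV_on C (fun y => (p t x y)%:E) + (exit_bound d t r * (2 * delta) ^+ d)%:E)%E.
  rewrite -hPK (killed_event _ _ t0 hB) CE.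
  apply: (@le_trans _ _ (P ((end_event B t delta `\` \bigcup_n grid_exit B t xlo xhi n)
     `|` ((\bigcup_n grid_exit B t xlo xhi n) `&` end_event B t delta)))).
    apply: le_measure; rewrite ?inE//.
      by apply: measurableU; [exact: measurableD|exact: measurableI].
    by move=> w endw; have [ex|nex] := pselect ((\bigcup_n grid_exit B t xlo xhi n) w);
      [right|left].
  apply: le_trans (measureU2 _ _ _) _; [exact: measurableD|exact: measurableI|].
  by apply: leeD.
move=> /(le_trans (brownian_cube_ge hB t0 d0)) h.
have {}h := le_trans h (leeD upper (lexx _)).
move: h; rewrite -EFinD lee_fin exprMn mulrA -/k -mulrDl ler_pM2r ?exprn_gt0//.
have : heat_peak d t - e <= heat_peak d t * expR (- (delta ^+ 2 / (4 * t))) ^+ d.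
  rewrite -expRM_natr.
  apply: (@le_trans _ _ (heat_peak d t * (1 + - (delta ^+ 2 / (4 * t)) * d%:R))); last first.
    by rewrite ler_pM2l// expR_ge1Dx.
  rewrite mulrDr mulr1 lerD2l mulNr mulrN lerN2.
  have : delta ^+ 2 <= z.
    by apply: le_trans dz; rewrite expr2 -[leRHS]mulr1 ler_pM2l.
  rewrite /z ler_pdivlMr ?mulr_gt0// => h.
  have -> : heat_peak d t * (delta ^+ 2 / (4 * t) * d%:R)
      = delta ^+ 2 * (d%:R * heat_peak d t) / (4 * t) by field; rewrite gt_eqF.
  by rewrite ler_pdivrMr ?mulr_gt0.
rewrite /e; lra.
Qed.

End killed_density.

(** * Limits of the cycle weights *)

Lemma bernoulli_le (R : realDomainType) (y : R) n : 0 <= y <= 1 ->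
  1 - n%:R * y <= (1 - y) ^+ n.
Proof.
move=> /andP[y0 y1]; elim: n => [|n IH]; first by rewrite mul0r subr0 expr0.
rewrite exprS; apply: (@le_trans _ _ ((1 - y) * (1 - n%:R * y))); last first.
  by rewrite ler_wpM2l// subr_ge0.
have : 0 <= n%:R * y * y by rewrite !mulr_ge0.
by rewrite -natr1; lra.
Qed.

Section cycle_weight_limits.
Context {R : realType}.
Variables (d : nat) (beta mu : R) (pDir : nat -> R -> 'rV[R]_d -> 'rV[R]_d -> R).
Hypotheses (hd : (0 < d)%N) (hbeta : 0 < beta).

Let near_ge (A : R) : \forall N \near \oo, A <= N%:R.
Proof. exact: nbhs_infty_ger. Qed.

Let q0 k : 0 < q d beta mu k.+1. Proof. exact: q_gt0. Qed.

Section dirichlet.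
Hypothesis hDir : forall N, (0 < N)%N -> killed_transition_density (box N) (pDir N).

Let time_gt0 k : 0 < k.+1%:R * beta. Proof. by rewrite mulr_gt0. Qed.

Let coef_gt0 N k : (0 < N)%N ->
  0 < expR (beta * mu * k.+1%:R) / (k.+1%:R * box_vol R d N).
Proof.
move=> N0; rewrite divr_gt0 ?expR_gt0// mulr_gt0// exprn_gt0// mulr_gt0//.
by rewrite ltr0n.
Qed.

Let diag_bounds N k x : (0 < N)%N -> box N x ->
  (0%:E <= (pDir N (k.+1%:R * beta) x x)%:E <= (heat_peak d (k.+1%:R * beta))%:E)%E.
Proof.
move=> N0 Dx; have [pos _ _] := hDir N0.
by rewrite !lee_fin pos//= (killed_diag_le (hDir N0)).
Qed.

Lemma q_bc_dirichlet_bounds N k : (0 < N)%N ->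
  0 <= q_bc beta mu pDir Dirichlet N k.+1 <= q d beta mu k.+1.
Proof.
move=> N0; rewrite /q_bc; case: ifP => kN; last by rewrite lexx ltW.
have /andP[h1 h2] := fine_integral_box_bounds (lexx 0) (fun x => @diag_bounds N k x N0).
have c0 := coef_gt0 k N0.
have v0 : box_vol R d N != 0 by rewrite expf_neq0// mulf_neq0// pnatr_eq0 -lt0n.
rewrite mul0r in h1; rewrite mulr_ge0 ?(ltW c0)//=.
rewrite -[leRHS]mul1r -(cycle_weight_heat_peak d mu 1 k hbeta v0).
by rewrite ler_pM2l// mul1r.
Qed.

(** Only points at distance at least r from the boundary are kept, a fraction (1 - r / N)^d of the
    volume, and there the density is at least (1 - e) times the free one. *)
Lemma q_bc_dirichlet_lower N k (e r : R) : (k < N)%N -> 0 < r -> r < N%:R -> e <= 1 ->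
  exit_bound d (k.+1%:R * beta) r * 2 ^+ d <= e * heat_peak d (k.+1%:R * beta) ->
  (1 - e) * (1 - r / N%:R) ^+ d * q d beta mu k.+1
    <= q_bc beta mu pDir Dirichlet N k.+1.
Proof.
move=> kN r0 rN e1 eb; rewrite /q_bc kN.
have N0 : (0 < N)%N by exact: leq_ltn_trans kN.
have N0' : (0 : R) < N%:R by rewrite ltr0n.
have c0 := coef_gt0 k N0.
have v0 : box_vol R d N != 0 by rewrite expf_neq0// mulf_neq0// pnatr_eq0 -lt0n.
rewrite -(cycle_weight_heat_peak d mu _ k hbeta v0) ler_pM2l//.
set p := heat_peak d _ in eb *.
have p0 : 0 < p by exact: heat_peak_gt0.
set I := integral_rV_on _ _.
have L0 : 0 <= (1 - e) * p by rewrite mulr_ge0 ?subr_ge0// ltW.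
have Ifin : I \is a fin_num.
  have h x : box N x -> (0 <= (pDir N (k.+1%:R * beta) x x)%:E)%E.
    by move=> Dx; have /andP[] := diag_bounds k N0 Dx.
  rewrite ge0_fin_numE; last first.
    apply: integral_rV_ge0 => x; rewrite patchE; case: ifPn => // /set_mem; exact: h.
  apply: (@le_lt_trans _ _ (p * box_vol R d N)%:E); last exact: ltry.
  rewrite -integral_box_cst ?(ltW p0)//; apply: ge0_le_integral_rV_on => // x Dx.
    by have /andP[] := diag_bounds k N0 Dx.
  by rewrite lee_fin ltW.
rewrite -lee_fin fineK//.
apply: (@le_trans _ _ (integral_rV_on (cube (fun=> - (N%:R - r)) (fun=> N%:R - r))
    (fun _ : 'rV[R]_d => ((1 - e) * p)%:E))).
  rewrite integral_rV_on_cube//; last by move=> _; rewrite ge0_cp// subr_ge0 ltW.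
  rewrite prodr_const card_ord lee_fin.
  have -> : N%:R - r - - (N%:R - r) = 2 * N%:R * (1 - r / N%:R).
    by field; rewrite gt_eqF.
  by rewrite /box_vol [(2 * N%:R * _) ^+ d]exprMn le_eqVlt; apply/orP; left; apply/eqP; ring.
apply: ge0_le_integral_rV_on.
- by move=> x h l; have /andP[h1 h2] := h l; apply/andP; split; lra.
- by move=> x _; rewrite lee_fin.
- move=> x h; rewrite lee_fin.
  apply: (@le_trans _ _ (p - exit_bound d (k.+1%:R * beta) r * 2 ^+ d)); first by lra.
  apply: (killed_diag_ge (hDir N0)) => // l.
  by rewrite ler_norml; have := h l.
- by move=> x Dx; have /andP[] := diag_bounds k N0 Dx.
Qed.

Lemma q_bc_dirichlet_cvg k :
  q_bc beta mu pDir Dirichlet N k.+1 @[N --> \oo] --> q d beta mu k.+1.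
Proof.
apply/cvgrPdist_le => e e0.
pose Q := q d beta mu k.+1.
have Q0 : 0 < Q by exact: q0.
(* Half of the error is for exits, half for the boundary layer. The distance [r] depends on k and e
   only and is fixed before N grows. *)
pose eps := Num.min 1 (e / 2 / Q).
have eQ : 0 < e / 2 / Q by rewrite divr_gt0// divr_gt0.
have eps0 : 0 < eps by rewrite lt_min ltr01.
have [eps1 epsQ] : eps <= 1 /\ eps <= e / 2 / Q by rewrite /eps !ge_min !lexx orbT.
have p0 := heat_peak_gt0 d (time_gt0 k).
pose e' := eps * heat_peak d (k.+1%:R * beta) / 2 ^+ d.
have e'0 : 0 < e' by rewrite divr_gt0 ?exprn_gt0// mulr_gt0.
have [r r0 hr] := exit_bound_cvg0 (k.+1%:R * beta) hd e'0.
near=> N.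
have kN : (k < N)%N by near: N; exact: nbhs_infty_gt.
have N0 : (0 < N)%N by exact: leq_ltn_trans kN.
have N0' : (0 : R) < N%:R by rewrite ltr0n.
have rN : r < N%:R.
  by apply: (@lt_le_trans _ _ (r + 1)); [rewrite ltrDl|near: N; exact: near_ge].
have rNe : d%:R * (r / N%:R) <= e / 2 / Q.
  rewrite mulrA ler_pdivrMr// -ler_pdivrMl//.
  by near: N; exact: near_ge.
have /andP[_ up] := q_bc_dirichlet_bounds k N0.
have eb : exit_bound d (k.+1%:R * beta) r * 2 ^+ d <= eps * heat_peak d (k.+1%:R * beta).
  by rewrite -ler_pdivlMr// exprn_gt0.
have low := q_bc_dirichlet_lower kN r0 rN eps1 eb.
have rN01 : 0 <= r / N%:R <= 1 by rewrite divr_ge0 ?(ltW r0)// ler_pdivrMr// mul1r ltW.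
have bern := bernoulli_le d rN01.
rewrite ger0_norm ?subr_ge0// lerBlDr -lerBlDl; apply: le_trans low.
rewrite -/Q.
apply: (@le_trans _ _ ((1 - eps) * (1 - d%:R * (r / N%:R)) * Q)); last first.
  by rewrite ler_pM2r// ler_wpM2l// subr_ge0.
have h : (eps + d%:R * (r / N%:R)) * Q <= e.
  by rewrite -ler_pdivlMr// (le_trans (lerD epsQ rNe))// -mulrDl -splitr.
have : 0 <= eps * (d%:R * (r / N%:R)) * Q.
  apply: mulr_ge0; last exact: ltW.
  apply: mulr_ge0; first exact: ltW.
  by rewrite mulr_ge0//; case/andP: rN01.
by lra.
Unshelve. all: by end_near. Qed.

End dirichlet.

(** The three properties of the weights required by [poisson_ldp]; in the periodic case the factor 2
    absorbs the lattice correction. *)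
Lemma q_bc_limit bc :
  (bc = Dirichlet -> forall N, (0 < N)%N -> killed_transition_density (box N) (pDir N)) ->
  [/\ forall N k, (0 < N)%N -> 0 <= q_bc beta mu pDir bc N k.+1,
      \forall N \near \oo, forall k, q_bc beta mu pDir bc N k.+1 <= 2 * q d beta mu k.+1
    & forall k, q_bc beta mu pDir bc N k.+1 @[N --> \oo] --> q d beta mu k.+1].
Proof.
have q2 k : q d beta mu k.+1 <= 2 * q d beta mu k.+1 by have := q0 k; lra.
case: bc => hbc.
- split => [N k _||k]; [exact: ltW (q0 k)|by apply: nearW => N k; exact: q2|exact: cvg_cst].
- have [M M0 hM] := q_bc_periodic mu pDir hbeta.
  have small (e : R) : 0 < e -> \forall N \near \oo, expR (1 - N%:R / beta) * M <= e.
    move=> e0; near=> N.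
    have h : expR (1 - N%:R / beta) <= e / (M + 1).
      have eM : 0 < e / (M + 1) by rewrite divr_gt0// ltr_wpDl.
      rewrite -[leRHS]lnK ?posrE// ler_expR lerBlDr -lerBlDl ler_pdivlMr//.
      by near: N; exact: near_ge.
    apply: (@le_trans _ _ (e / (M + 1) * M)); first by rewrite ler_wpM2r.
    by rewrite mulrAC ler_pdivrMr ?ltr_wpDl// ler_pM2l// lerDl.
  split.
  + move=> N k N0; rewrite /q_bc; case: ifP => // _.
    rewrite mulr_ge0//; first by rewrite divr_ge0 ?expR_ge0// mulr_ge0// exprn_ge0// mulr_ge0.
    apply: fine_ge0; apply: integral_rV_ge0 => x; rewrite patchE; case: ifPn => // _.
    apply: esum_ge0 => z _; rewrite lee_fin mulr_ge0 ?expR_ge0//.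
    by rewrite powR_ge0.
  + near=> N => k.
    have bN : beta <= N%:R by near: N; exact: near_ge.
    have [kN|Nk] := ltnP k N; last first.
      by rewrite /q_bc ltnNge Nk/= mulr_ge0// ltW.
    have /andP[_ h] := hM N k kN bN; apply: (le_trans h); rewrite ler_pM2r//.
    suff : expR (1 - N%:R / beta) * M <= 1 by lra.
    by near: N; exact: small.
  + move=> k; apply/cvgrPdist_le => e e0; near=> N.
    have bN : beta <= N%:R by near: N; exact: near_ge.
    have kN : (k < N)%N by near: N; exact: nbhs_infty_gt.
    have /andP[h1 h2] := hM N k kN bN.
    rewrite distrC ger0_norm ?subr_ge0// lerBlDl; apply: (le_trans h2).
    rewrite mulrDl mul1r lerD2l -ler_pdivlMr//.
    by near: N; apply: small; rewrite divr_gt0.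
- have hD := hbc erefl; split.
  + by move=> N k N0; have /andP[] := q_bc_dirichlet_bounds hD k N0.
  + near=> N => k; have N0 : (0 < N)%N by near: N; exact: nbhs_infty_gt.
    by have /andP[_ h] := q_bc_dirichlet_bounds hD k N0; exact: le_trans h (q2 k).
  + by move=> k; exact: q_bc_dirichlet_cvg.
Unshelve. all: by end_near. Qed.

End cycle_weight_limits.

(** * Large deviations of the empirical cycle counts *)

Theorem proposition1p2 (R : realType) (d : nat) (beta mu : R)
    (bc : boundary_condition)
    (pDir : nat -> R -> 'rV[R]_d -> 'rV[R]_d -> R)
    (dT : nat -> measure_display) (T : forall N : nat, measurableType (dT N))
    (P : forall N : nat, probability (T N) R)
    (Nk : forall N k : nat, {RV P N >-> nat})
    (hd : (0 < d)%N) (hbeta : 0 < beta) (hmu : mu <= 0)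
    (hDir : bc = Dirichlet -> forall N : nat, (0 < N)%N ->
      killed_transition_density (box N) (pDir N))
    (hpoisson : forall N k : nat, (0 < N)%N ->
      forall A : set nat, distribution (P N) (Nk N k) A
        = poisson_prob (box_vol R d N * q_bc beta mu pDir bc N k.+1) 0 A)
    (hindep : forall N : nat, (0 < N)%N ->
      mutually_independent (P N) (fun k : nat => (Nk N k : T N -> nat))) :
  LDP (box_vol R d)
    (fun N => law_cycle_count d N (P N) (fun k => (Nk N k : T N -> nat)))
    (rate_function d beta mu).
Proof.
have -> : rate_function d beta mu =
    (entropy_rate (fun k => q d beta mu k.+1) : l1 R -> \bar R).
  apply/funext => x; apply: rate_functionE; first by move=> k; exact: q_gt0.
  exact: qbar_lty.
have V_gt0 N : (0 < N)%N -> 0 < box_vol R d N.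
  by move=> N0; rewrite exprn_gt0// mulr_gt0// ltr0n.
have Voo : box_vol R d @ \oo --> +oo.
  apply/cvgryPge => A; near=> N.
  have N1 : (1 : R) <= N%:R by near: N; exact: nbhs_infty_ger.
  apply: (@le_trans _ _ N%:R); first by near: N; exact: nbhs_infty_ger.
  rewrite /box_vol -(prednK hd) exprS.
  apply: (@le_trans _ _ (2 * N%:R * 1)); first by lra.
  by rewrite ler_wpM2l ?mulr_ge0// exprn_ege1//; lra.
have [S qS] := cycle_weight_moment hd hbeta hmu.
have [a0 a2 aq] := q_bc_limit mu hd hbeta hDir.
have c0 : (0 : R) < ln 2 / 4 by rewrite divr_gt0// ln_gt0// ltr1n.
(* The law of the counts unfolds to that of [scaled_seq] at scale [box_vol R d N]. *)
apply: (poisson_ldp V_gt0 Voo (fun k => q_gt0 d mu hbeta k) c0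
  (@cycle_moment_weight_ge R) (@cycle_moment_weight_cvg R) qS a0 (ltr0n _ 2) a2 aq).
- by move=> N k; exact: measurable_funPT.
- exact: hindep.
- by move=> N k N0 A; rewrite -hpoisson.
Unshelve. all: by end_near. Qed.
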